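(* Let $k$ be a field, $n \ge 4$, let $G$ be a simple graph on the vertex set $\{1,\dots,n\}$, and let $m \ge 3$ be an integer. Then $I_G^m$ is a Cohen-Macaulay ideal if and only if $G$ is a cycle of length 4.
   Context: Let $S = k[x_1,\dots,x_n]$ be a polynomial ring. A simple graph here means a finite undirected graph without multiple edges, without loops and without isolated vertices (every vertex in $\{1,\dots,n\}$ belongs to an edge); so if $G$ is a cycle, it passes through all $n$ vertices. We write $\{i,j\}\in G$ if $\{i,j\}$ is an edge of $G$. For $i \ne j$ put $P_{ij} = (x_t \mid t \ne i,j)$, the prime ideal of $S$ generated by all variables other than $x_i,x_j$. Define $I_G = \bigcap_{\{i,j\}\in G} P_{ij}$; $I_G^m$ denotes the ordinary $m$-th power. An ideal $I$ of $S$ is called Cohen-Macaulay if $S/I$ is a Cohen-Macaulay ring. *)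

(* Defs.v *)
From HB Require Import structures.
From mathcomp Require Import all_boot all_order all_algebra.
From mathcomp Require Import boolp classical_sets.
From mathcomp Require Import ring_quotient.
From mathcomp Require Import mpoly.

Set Implicit Arguments.
Unset Strict Implicit.
Unset Printing Implicit Defensive.

Import GRing.Theory.

Local Open Scope classical_set_scope.
Local Open Scope ring_scope.

(* Ideals are Prop-valued sets rather than the library's [idealr], whose
   elements are boolean predicates and always proper: the unit ideal and
   ideals without a membership test are needed below. *)

Definition is_ideal (R : comNzRingType) (I : set R) : Prop :=
  [/\ I 0,
      forall x y, I x -> I y -> I (x + y) &
      forall a x, I x -> I (a * x)].

Definition ideal_gen (R : comNzRingType) (A : set R) : set R :=
  \bigcap_(I in [set I | is_ideal I /\ A `<=` I]) I.

Definition ideal_mul (R : comNzRingType) (I J : set R) : set R :=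
  ideal_gen [set x | exists a b, [/\ I a, J b & x = a * b]].

(* The ordinary power; the zeroth power is the unit ideal. *)
Definition ideal_pow (R : comNzRingType) (I : set R) (m : nat) : set R :=
  iter m (ideal_mul I) setT.

Definition is_prime (R : comNzRingType) (P : set R) : Prop :=
  [/\ is_ideal P, ~ P 1 & forall a b, P (a * b) -> P a \/ P b].

Definition is_maximal (R : comNzRingType) (M : set R) : Prop :=
  [/\ is_ideal M, ~ M 1 &
      forall J, is_ideal J -> M `<=` J -> ~ J 1 -> J = M].

Definition noetherian (R : comNzRingType) : Prop :=
  forall I : set R, is_ideal I -> exists s : seq R, I = ideal_gen [set` s].

(* p 0 < p 1 < ... < p l = P, a strict chain of primes of length l. *)
Definition prime_chain_below (R : comNzRingType) (P : set R) (l : nat) : Prop :=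
  exists p : nat -> set R,
    [/\ forall i, (i <= l)%N -> is_prime (p i),
        forall i, (i < l)%N -> p i `<=` p i.+1 /\ p i <> p i.+1 &
        p l = P].

Definition height_eq (R : comNzRingType) (P : set R) (d : nat) : Prop :=
  prime_chain_below P d /\ forall l, prime_chain_below P l -> (l <= d)%N.

(* The i-th term is a nonzerodivisor modulo the ideal of the previous ones,
   and the whole sequence does not generate the unit ideal. *)
Definition regular_seq (R : comNzRingType) (s : seq R) : Prop :=
  (forall i, (i < size s)%N -> forall a,
     ideal_gen [set` take i s] (nth 0 s i * a) -> ideal_gen [set` take i s] a)
  /\ ~ ideal_gen [set` s] 1.

Definition regular_seq_in (R : comNzRingType) (P : set R) (l : nat) : Prop :=
  exists s : seq R, [/\ regular_seq s, [set` s] `<=` P & size s = l].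

Definition depth_eq (R : comNzRingType) (P : set R) (d : nat) : Prop :=
  regular_seq_in P d /\ forall l, regular_seq_in P l -> (l <= d)%N.

(* Eisenbud, Commutative Algebra, Section 18.2: a Noetherian ring R is
   Cohen-Macaulay if depth(M) = codim(M) for every maximal ideal M of R. *)
Definition cohen_macaulay (R : comNzRingType) : Prop :=
  noetherian R /\
  forall M : set R, is_maximal M -> exists d, height_eq M d /\ depth_eq M d.

(* [J] is the library's packaging of the proper ideal [I], unique up to
   extensional equality. The unit ideal has no such packaging, so the zero
   ring is not considered. *)
Definition cohen_macaulay_ideal (R : comNzRingType) (I : set R) : Prop :=
  exists J : idealr R, [set` J] = I /\ cohen_macaulay {ideal_quot J}.

Record simple_graph (n : nat) := SimpleGraph {
  edge : rel 'I_n;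
  edge_sym : forall i j, edge i j = edge j i;
  edge_irrefl : irreflexive edge;
  edge_no_isolated : forall i, exists j, edge i j
}.

Definition is_cycle_of_length (n : nat) (G : simple_graph n) (l : nat) : Prop :=
  exists s : seq 'I_n,
    [/\ (3 <= l)%N, size s = l, uniq s &
        forall i j, edge G i j =
          (i \in s) && ((j == next s i) || (i == next s j))].

Definition pair_prime (k : fieldType) (n : nat) (i j : 'I_n) :
    set {mpoly k[n]} :=
  ideal_gen [set 'X_t | t in [set t : 'I_n | t != i /\ t != j]].

Arguments pair_prime k {n} i j.

Definition graph_ideal (k : fieldType) (n : nat) (G : simple_graph n) :
    set {mpoly k[n]} :=
  \bigcap_(e in [set e : 'I_n * 'I_n | edge G e.1 e.2]) pair_prime k e.1 e.2.

Arguments graph_ideal k {n} G.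

(* Main.v *)
(** A Cohen-Macaulay quotient [S / I ^ m] has a regular sequence of length two
at the origin, since its height there is at least two.  Hence the zeroth and
first local cohomology vanish: no nonzero element is killed by a power of the
maximal ideal, and sections over the punctured spectrum extend.  If [w] is a
monomial satisfying the symbolic power condition, the section equal to
[w / x_i ^ s] where [x_i] is invertible and to [0] where another variable is
extends for every [s], which forces [w] into [I ^ m]; a weight function
separates such a monomial from [I ^ m] as soon as [G] has a triangle, three
pairwise non-adjacent vertices, or five vertices.  Among the remaining graphs
on four vertices, those other than the four-cycle have two disjoint edges
[a b] and [c d] that are the facets of the degree complex of
[x_a ^ (m - 1) x_d ^ (m - 1)], which yields a section that does not extend.

Conversely the ideal of the cycle [a b c d] is [(x_a x_c, x_b x_d)].  With
[s = x_a - x_c] and [t = x_b - x_d], the ring [S] is [k[s][t][x_a][x_b]] and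
the two generators are monic in [x_a] and [x_b].  Every maximal ideal
containing [I] contains nonzero elements [p(s)] and [q(t)], and these form a
regular sequence modulo [I ^ m] because each [I ^ i / I ^ (i + 1)] is free over
[S / I], which is free over [k[s][t]].  Chains of primes have length at most
two because any three elements of [k[s][t]] are algebraically dependent. *)

Require Import Defs.
From HB Require Import structures.
From mathcomp Require Import all_boot all_order all_algebra.
From mathcomp Require Import boolp classical_sets.
From mathcomp Require Import ring_quotient generic_quotient.
From mathcomp Require Import ring zify.
From mathcomp Require Import mpoly.

Set Implicit Arguments.
Unset Strict Implicit.
Unset Printing Implicit Defensive.

Import GRing.Theory.

Local Open Scope classical_set_scope.
Local Open Scope ring_scope.

(** * Ideals and regular sequences *)

Section Ideals.
Variable R : comNzRingType.
Implicit Types (I J K M P Q W : set R) (s : seq R).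

Lemma ideal0 I : is_ideal I -> I 0. Proof. by case. Qed.

Lemma idealD I x y : is_ideal I -> I x -> I y -> I (x + y).
Proof. by case=> _ h _; apply: h. Qed.

Lemma ideal_mull I a x : is_ideal I -> I x -> I (a * x).
Proof. by case=> _ _; apply. Qed.

Lemma ideal_mulr I a x : is_ideal I -> I x -> I (x * a).
Proof. by rewrite mulrC; apply: ideal_mull. Qed.

Lemma idealN I x : is_ideal I -> I x -> I (- x).
Proof. by move=> iI Ix; rewrite -mulN1r; apply: ideal_mull. Qed.

Lemma idealB I x y : is_ideal I -> I x -> I y -> I (x - y).
Proof. by move=> iI Ix Iy; apply: idealD => //; apply: idealN. Qed.

Lemma ideal_sum I (T : Type) (r : seq T) (p : pred T) (F : T -> R) :
  is_ideal I -> (forall i, p i -> I (F i)) -> I (\sum_(i <- r | p i) F i).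
Proof.
move=> iI h; elim/big_ind: _ => //; first exact: ideal0.
by move=> x y; apply: idealD.
Qed.

Lemma ideal_transfer I x y : is_ideal I -> I (x - y) -> I x -> I y.
Proof. by move=> iI h Ix; rewrite -[y](subKr x); apply: idealB. Qed.

Lemma ideal_setT : is_ideal (@setT R). Proof. by []. Qed.

Lemma ideal_zero : is_ideal [set (0 : R)].
Proof.
by split => // [x y /= -> ->|a x /= ->]; rewrite ?addr0 ?mulr0.
Qed.

Lemma ideal_genP (A : set R) : is_ideal (ideal_gen A).
Proof.
split=> [|x y gx gy|a x gx] J [iJ AJ]; first exact: ideal0.
- by apply: idealD => //; [apply: gx|apply: gy].
- by apply: ideal_mull => //; apply: gx.
Qed.

Lemma ideal_gen_sub (A : set R) : A `<=` ideal_gen A.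
Proof. by move=> x Ax J [_]; apply. Qed.

Lemma ideal_gen_min (A : set R) I : is_ideal I -> A `<=` I -> ideal_gen A `<=` I.
Proof. by move=> iI AI x; apply. Qed.

Lemma ideal_gen_seqP s x :
  ideal_gen [set` s] x <-> exists c : nat -> R, x = \sum_(i < size s) c i * s`_i.
Proof.
split=> [|[c ->]].
  apply: (ideal_gen_min (I := [set x | exists c : nat -> R,
    x = \sum_(i < size s) c i * s`_i])).
    split=> [|y z /= [c ->] [d ->]|a y /= [c ->]].
    - by exists (fun=> 0); rewrite big1 // => i _; rewrite mul0r.
    - exists (fun i => c i + d i); rewrite -big_split /=.
      by apply: eq_bigr => i _; rewrite mulrDl.
    - exists (fun i => a * c i); rewrite mulr_sumr.
      by apply: eq_bigr => i _; rewrite mulrA.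
  move=> y /= ys; exists (fun i => (i == index y s)%:R).
  have hi : (index y s < size s)%N by rewrite index_mem.
  rewrite (bigD1 (Ordinal hi)) //= eqxx mul1r nth_index //.
  rewrite big1 ?addr0 // => i; rewrite -val_eqE /= => /negPf ->.
  by rewrite mul0r.
apply: ideal_sum => [|i _]; first exact: ideal_genP.
by apply: ideal_mull (ideal_genP _) _; apply: ideal_gen_sub => /=; apply: mem_nth.
Qed.

Definition ideal_add I J : set R := [set x | exists y z, [/\ I y, J z & x = y + z]].

Lemma ideal_addP I J : is_ideal I -> is_ideal J -> is_ideal (ideal_add I J).
Proof.
move=> iI iJ; split=> [|_ _ [a [b [Ia Jb ->]]] [c [d [Ic Jd ->]]]|r _ [a [b [Ia Jb ->]]]].
- by exists 0, 0; rewrite addr0; split => //; apply: ideal0.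
- by exists (a + c), (b + d); rewrite addrACA; split => //; apply: idealD.
- by exists (r * a), (r * b); rewrite mulrDr; split => //; apply: ideal_mull.
Qed.

Lemma ideal_addl I J : is_ideal J -> I `<=` ideal_add I J.
Proof. by move=> iJ x Ix; exists x, 0; rewrite addr0; split => //; apply: ideal0. Qed.

Lemma ideal_addr I J : is_ideal I -> J `<=` ideal_add I J.
Proof. by move=> iI x Jx; exists 0, x; rewrite add0r; split => //; apply: ideal0. Qed.

Definition principal (u : R) : set R := [set x | exists c, x = c * u].

Lemma principalP u : is_ideal (principal u).
Proof.
split=> [|_ _ [a ->] [b ->]|r _ [a ->]].
- by exists 0; rewrite mul0r.
- by exists (a + b); rewrite mulrDl.
- by exists (r * a); rewrite mulrA.
Qed.

Lemma principal_id u : principal u u.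
Proof. by exists 1; rewrite mul1r. Qed.

Definition regular_mod K (u : R) := forall w, K (u * w) -> K w.

Lemma regular_modX K u n : regular_mod K u -> regular_mod K (u ^+ n).
Proof.
move=> ru; elim: n => [|n IH] w; first by rewrite expr0 mul1r.
by rewrite exprSr -mulrA => /IH /ru.
Qed.

(** Zorn's lemma yields an ideal maximal among those containing [K] and avoiding [W]. If [a] and [b]
    lie outside it, enlarging it by either one meets [W], and the product of the two elements of [W]
    so found excludes [a * b]. *)
Lemma prime_disjoint K (W : set R) :
  is_ideal K -> W 1 -> (forall x y, W x -> W y -> W (x * y)) ->
  (forall x, W x -> ~ K x) ->
  exists Q, [/\ is_prime Q, K `<=` Q & forall x, W x -> ~ Q x].
Proof.
move=> iK W1 WM WK.
pose good A := is_ideal A /\ forall x, W x -> ~ A x.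
(* Zorn is applied to sets [A] for which the union with [K] is good, so that the empty chain also
   has a good union, namely [K]. *)
have [F FP Ftot|A [[iA dA] maxA]] := @Zorn_bigcup R (fun A => good (A `|` K)).
  have [[A0 FA0]|F0] := pselect (exists A, F A); last first.
    suff -> : \bigcup_(X in F) X = set0 by rewrite set0U; split.
    by apply/seteqP; split => // x [X FX _]; case: F0; exists X.
  split=> [|x Wx [[X FX Xx]|Kx]]; last 2 first.
  - by case: (FP X FX) => _ /(_ x Wx); apply; left.
  - exact: WK Kx.
  split=> [|x y hx hy|a x hx].
  - by right; apply: ideal0.
  - have [X [FX Xx Xy]] : exists X, [/\ F X, (X `|` K) x & (X `|` K) y].
      case: hx hy => [[X FX Xx]|Kx] [[Y FY Yy]|Ky].
      + by case: (Ftot _ _ FX FY) => [XY|YX];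
          [exists Y|exists X]; split => //; left => //; [apply: XY|apply: YX].
      + by exists X; split => //; [left|right].
      + by exists Y; split => //; [right|left].
      + by exists A0; split => //; right.
    case: (idealD (proj1 (FP X FX)) Xx Xy) => [Xxy|]; last by right.
    by left; exists X.
  - case: hx => [[X FX Xx]|Kx]; last by right; apply: ideal_mull.
    case: (ideal_mull a (proj1 (FP X FX)) (or_introl Xx)) => [Xax|]; last by right.
    by left; exists X.
have grow B : good B -> A `|` K `<=` B -> B `<=` A `|` K.
  move=> gB AB; apply: contrapT => nBA; apply: (maxA B).
    split=> [x Ax|BA]; first by apply: AB; left.
    by apply: nBA => x /BA; left.
  suff -> : B `|` K = B by [].
  by apply/seteqP; split => [x [|Kx]//|x Bx]; [apply: AB; right|left].
exists (A `|` K); split; [|by move=> x Kx; right|exact: dA].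
split => // [|a b Qab]; first exact: dA.
apply: contrapT => /not_orP [nQa nQb].
have meet c : ~ (A `|` K) c -> exists w q r, [/\ W w, (A `|` K) q & w = q + r * c].
  move=> nQc; apply: contrapT => nw; apply: nQc.
  have iPc := principalP c.
  apply: (grow (ideal_add (A `|` K) (principal c))).
  - split; first exact: ideal_addP.
    move=> x Wx [y [_ [Qy [r ->] xE]]]; apply: nw.
    by exists x, y, r.
  - exact: ideal_addl.
  - exact: ideal_addr (principal_id c).
have [w1 [q1 [r1 [W1' Q1 e1]]]] := meet a nQa.
have [w2 [q2 [r2 [W2' Q2 e2]]]] := meet b nQb.
apply: (dA (w1 * w2)); first exact: WM.
rewrite e1 e2.
have -> : (q1 + r1 * a) * (q2 + r2 * b) =
  (q2 + r2 * b) * q1 + r1 * a * q2 + r1 * r2 * (a * b) by ring.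
by apply: idealD => //; [apply: idealD => //|]; apply: ideal_mull.
Qed.

Lemma maximal_prime M : is_maximal M -> is_prime M.
Proof.
move=> [iM M1 maxM].
have [||||Q [pQ MQ QW]] := @prime_disjoint M [set 1] => //.
- by move=> x y /= -> ->; rewrite mulr1.
- by move=> x /= ->.
by case: (pQ) => iQ _ _; rewrite -(maxM Q iQ MQ (QW 1 erefl)).
Qed.

(** This gives depth at most height without localizing. The last element [a] is regular modulo the
    ideal of the others, which lies in [P], so that ideal contains no product [a ^+ n * y] with [y]
    outside [P]. A prime avoiding these products lies in [P] and misses [a], and the induction
    continues below it. *)
Lemma regular_seq_chain (P : set R) (s : seq R) : is_prime P -> regular_seq s -> [set` s] `<=` P ->
  prime_chain_below P (size s).
Proof.
elim/last_ind: s P => [|s a IH] P pP rs sP.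
  by exists (fun=> P); split.
case: rs => rs s1.
have iP : is_ideal P by case: pP.
have iS := ideal_genP [set` s].
have SP : ideal_gen [set` s] `<=` P.
  apply: ideal_gen_min => // x xs; apply: sP.
  by move: xs => /= xs; rewrite mem_rcons inE xs orbT.
have aP : P a by apply: sP => /=; rewrite mem_rcons inE eqxx.
have ra : regular_mod (ideal_gen [set` s]) a.
  move=> w; have := rs (size s); rewrite size_rcons ltnSn => /(_ isT w).
  by rewrite -cats1 take_size_cat // nth_cat ltnn subnn.
pose W := [set x | exists n y, ~ P y /\ x = a ^+ n * y].
have [||||Q [pQ SQ QW]] := @prime_disjoint (ideal_gen [set` s]) W => //.
- by exists 0%N, 1; split; [case: pP|rewrite mulr1].
- move=> _ _ [n [y [Py ->]]] [p [z [Pz ->]]]; exists (n + p)%N, (y * z).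
  split; first by case: pP => _ _ h /h [].
  by rewrite exprD; ring.
- by move=> _ [n [y [Py ->]]] /(regular_modX ra) /SP.
have QP : Q `<=` P.
  move=> z Qz; apply: contrapT => nPz; apply: (QW z) => //.
  by exists 0%N, z; rewrite mul1r.
have Qa : ~ Q a.
  by apply: QW; exists 1%N, 1; rewrite mulr1; split => //; case: pP.
have rs' : regular_seq s.
  split=> [i his b|h].
    have := rs i; rewrite size_rcons ltnS (ltnW his) => /(_ isT b).
    rewrite -cats1 takel_cat ?(ltnW his) // nth_cat his; apply.
  by case: pP => _ + _; apply; apply: SP.
have [p [pp pc pl]] := IH Q pQ rs' (fun x xs => SQ x (ideal_gen_sub xs)).
exists (fun i => if (i <= size s)%N then p i else P); rewrite size_rcons; split.
- by move=> i _; case: leqP => // his; apply: pp.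
- move=> i; rewrite ltnS => his; rewrite his; case: ltnP => his'.
    exact: pc.
  have -> : i = size s by apply/eqP; rewrite eqn_leq his.
  by rewrite pl; split => // QeP; apply: Qa; rewrite QeP.
- by rewrite ltnn.
Qed.


Lemma sum_delta (T : finType) (i : T) (F : T -> R) :
  \sum_j (j == i)%:R * F j = F i.
Proof.
rewrite (bigD1 i) //= eqxx mul1r big1 ?addr0 // => j /negPf ->.
by rewrite mul0r.
Qed.

Lemma ideal_gen_rangeP (T : finType) (f : T -> R) x :
  ideal_gen (range f) x <-> exists c : T -> R, x = \sum_i c i * f i.
Proof.
split=> [|[c ->]].
  apply: (ideal_gen_min (I := [set x | exists c : T -> R, x = \sum_i c i * f i])).
    split=> [|y z /= [c ->] [d ->]|a y /= [c ->]].
    - by exists (fun=> 0); rewrite big1 // => i _; rewrite mul0r.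
    - exists (fun i => c i + d i); rewrite -big_split /=.
      by apply: eq_bigr => i _; rewrite mulrDl.
    - exists (fun i => a * c i); rewrite mulr_sumr.
      by apply: eq_bigr => i _; rewrite mulrA.
  by move=> _ [t _ <-]; exists (fun i => (i == t)%:R); rewrite sum_delta.
apply: ideal_sum => [|i _]; first exact: ideal_genP.
by apply: ideal_mull (ideal_genP _) _; apply: ideal_gen_sub; exists i.
Qed.

Lemma ideal_powP I m : is_ideal (ideal_pow I m).
Proof. by case: m => [|m]; [exact: ideal_setT|exact: ideal_genP]. Qed.

Lemma ideal_powS I m x y : I x -> ideal_pow I m y -> ideal_pow I m.+1 (x * y).
Proof. by move=> Ix Iy; apply: ideal_gen_sub; exists x, y. Qed.

(** The induction principle for ordinary powers: it is applied to weights, to products and to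
    preimages under ring morphisms. *)
Lemma ideal_pow_min I (F : nat -> set R) m : (forall m, is_ideal (F m)) ->
  F 0%N = setT -> (forall m x y, I x -> F m y -> F m.+1 (x * y)) ->
  ideal_pow I m `<=` F m.
Proof.
move=> iF F0 FS; elim: m => [|m IH]; first by rewrite F0.
by apply: ideal_gen_min => // _ [x [y [Ix /IH Fy ->]]]; apply: FS.
Qed.

Lemma ideal_powX I m x : I x -> ideal_pow I m (x ^+ m).
Proof.
by move=> Ix; elim: m => [//|m IH]; rewrite exprS; apply: ideal_powS.
Qed.

Lemma ideal_powSW I m : ideal_pow I m.+1 `<=` ideal_pow I m.
Proof.
apply: ideal_gen_min; first exact: ideal_powP.
by move=> _ [x [y [_ Iy ->]]]; apply: ideal_mull => //; apply: ideal_powP.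
Qed.

Lemma ideal_powW I m p : (m <= p)%N -> ideal_pow I p `<=` ideal_pow I m.
Proof.
move=> /subnK <-; elim: (p - m)%N => [//|q IH] x.
by rewrite addSn => /ideal_powSW /IH.
Qed.

Lemma ideal_powD I m p x y : ideal_pow I m x -> ideal_pow I p y ->
  ideal_pow I (m + p) (x * y).
Proof.
move=> + Iy.
apply: (ideal_pow_min (F := fun m => [set x | ideal_pow I (m + p) (x * y)])).
- move=> q; have iq := ideal_powP I (q + p); split=> [|a b|a b] /=.
  + by rewrite mul0r; apply: ideal0.
  + by rewrite mulrDl; apply: idealD.
  + by rewrite -mulrA; apply: ideal_mull.
- by apply/seteqP; split => // a _ /=; apply: ideal_mull => //; apply: ideal_powP.
- by move=> q a b Ia Ib /=; rewrite -mulrA; apply: (ideal_powS Ia Ib).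
Qed.

Lemma radicalP J : is_ideal J -> is_ideal [set x | exists L, J (x ^+ L)].
Proof.
move=> iJ; split=> [|x y /= [L hL] [K hK]|a x /= [L hL]].
- by exists 1%N; rewrite expr1; apply: ideal0.
- exists (L + K)%N; rewrite exprDn; apply: ideal_sum => // i _.
  rewrite -mulr_natr; apply: ideal_mulr => //; case: (leqP K i) => hi.
    by apply: ideal_mull => //; rewrite -(subnK hi) exprD; apply: ideal_mull.
  apply: ideal_mulr => //; have hi' : (L <= L + K - i)%N by lia.
  by rewrite -(subnK hi') exprD; apply: ideal_mull.
- by exists L; rewrite exprMn; apply: ideal_mull.
Qed.

(* The vanishing of the zeroth local cohomology. *)
Lemma regular_torsion_free (T : finType) (x : T -> R) N a v :
  (forall w, a * w = 0 -> w = 0) -> ideal_gen (range x) a ->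
  (forall i, x i ^+ N * v = 0) -> v = 0.
Proof.
move=> ra ax xv.
have iv : is_ideal [set r | r * v = 0].
  split=> [|r s /= rv sv|r s /= sv]; first by rewrite /= mul0r.
  - by rewrite mulrDl rv sv addr0.
  - by rewrite -mulrA sv mulr0.
have [|L /= aL] := ideal_gen_min (radicalP iv) _ ax.
  by move=> _ [i _ <-]; exists N; apply: xv.
by elim: L aL => [|L IH]; rewrite ?expr0 ?mul1r // exprS -mulrA => /ra.
Qed.

(* The vanishing of the first local cohomology: a section over the punctured
   spectrum of the ideal generated by the [x i], given by the fractions
   [u i / x i ^+ N], extends. *)
Lemma regular_extension (T : finType) (x u : T -> R) N a b :
  (forall w, a * w = 0 -> w = 0) ->
  (forall w, principal a (b * w) -> principal a w) ->
  ideal_gen (range x) a -> ideal_gen (range x) b ->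
  (forall i j, x i ^+ N * u j = x j ^+ N * u i) ->
  exists v, forall i, x i ^+ N * v = u i.
Proof.
move=> ra rb ax bx xu.
have raL L w : a ^+ L * w = 0 -> w = 0.
  by elim: L w => [|L IH] w; rewrite ?expr0 ?mul1r // exprS -mulrA => /ra /IH.
have rb1 (K : nat) y : principal a (b ^+ K * y) -> principal a y.
  by elim: K y => [|K IH] y; rewrite ?expr0 ?mul1r // exprS -mulrA => /rb /IH.
(* By induction on [L]: regularity of [b] modulo [a] splits off one factor [a] of [y], and
   regularity of [a] cancels it. *)
have rbL (K L : nat) y : principal (a ^+ L) (b ^+ K * y) -> principal (a ^+ L) y.
  elim: L y => [|L IH] y [z yz].
    by exists y; rewrite expr0 mulr1.
  have [|y' yE] := rb1 K y.
    by exists (z * a ^+ L); rewrite yz exprSr mulrA.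
  have [|y'' y'E] := IH y'.
    exists z; apply/eqP; rewrite -subr_eq0; apply/eqP; apply: ra.
    rewrite mulrBr; apply/eqP; rewrite subr_eq0; apply/eqP.
    have -> : a * (b ^+ K * y') = b ^+ K * y by rewrite yE; ring.
    by rewrite yz exprS; ring.
  by exists y''; rewrite yE y'E exprSr mulrA.
have iJ := ideal_genP (range (fun i => x i ^+ N)).
have rad r : ideal_gen (range x) r ->
    exists L (c : T -> R), r ^+ L = \sum_i c i * x i ^+ N.
  move=> /(ideal_gen_min (radicalP iJ)) [|L /ideal_gen_rangeP [c rL]].
    by move=> _ [i _ <-]; exists N; apply: ideal_gen_sub; exists i.
  by exists L, c.
have [L [c aL]] := rad a ax; have [K [d bK]] := rad b bx.
(* For [r = \sum_i e i * x i ^+ N], the element [phi e] stands for [r] times the section. *)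
pose phi (e : T -> R) := \sum_i e i * u i.
have phiE e f : (\sum_i f i * x i ^+ N) * phi e = (\sum_i e i * x i ^+ N) * phi f.
  rewrite !mulr_suml; under eq_bigr do rewrite mulr_sumr.
  under [RHS]eq_bigr do rewrite mulr_sumr.
  rewrite exchange_big /=; apply: eq_bigr => i _; apply: eq_bigr => j _.
  have := xu j i; move: (x i ^+ N) (x j ^+ N) => X Y h.
  have -> : f j * Y * (e i * u i) = f j * e i * (Y * u i) by ring.
  by rewrite h; ring.
(* The section equals both [phi c / a ^+ L] and [phi d / b ^+ K]. As [b ^+ K] is regular modulo
   [a ^+ L], the first fraction is an element of [R]. *)
have [|v phic] := rbL K L (phi c).
  by exists (phi d); rewrite bK phiE -aL mulrC.
exists v => i; apply/eqP; rewrite -subr_eq0; apply/eqP; apply: (raL L).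
apply/eqP; rewrite mulrBr subr_eq0; apply/eqP.
have := phiE (fun j => (j == i)%:R) c.
by rewrite /phi !sum_delta -aL => ->; rewrite -/(phi c) phic; ring.
Qed.

End Ideals.

(** * Monomial ideals *)

Section MonomialIdeals.
Variables (k : fieldType) (n : nat).
Local Notation S := {mpoly k[n]}.
Implicit Types (U V : set 'X_{1..n}) (f g : S) (A B : pred 'I_n).

Definition monomial_ideal U : set S := [set f | forall m, m \in msupp f -> U m].

Definition up_closed U := forall m m', U m -> U (m + m')%MM.

Lemma monomial_idealX U m : monomial_ideal U 'X_[m] <-> U m.
Proof.
split=> [|Um m']; first by apply; rewrite msuppX mem_seq1.
by rewrite msuppX mem_seq1 => /eqP ->.
Qed.

Lemma monomial_idealP U : up_closed U -> is_ideal (monomial_ideal U).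
Proof.
move=> Uup; split=> [m|f g If Ig m|f g Ig m].
- by rewrite msupp0.
- by move/msuppD_le; rewrite mem_cat => /orP [/If|/Ig].
- move/msuppM_le => /allpairsP [[m1 m2] /= [_ hm2 ->]].
  by rewrite addmC; apply: Uup; apply: Ig.
Qed.

Lemma monomial_ideal_min U (I : set S) : is_ideal I ->
  (forall m, U m -> I 'X_[m]) -> monomial_ideal U `<=` I.
Proof.
move=> iI UI f If; rewrite (mpolyE f) big_seq; apply: ideal_sum => // m hm.
by rewrite -mul_mpolyC; apply: ideal_mull => //; apply: UI; apply: If.
Qed.

Definition supp_meets A : set 'X_{1..n} := [set m | exists2 t, A t & m t != 0%N].

Lemma supp_meets_up A : up_closed (supp_meets A).
Proof. by move=> m m' [t At mt]; exists t => //; rewrite mnmDE addn_eq0 negb_and mt. Qed.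

Lemma supp_meetsU A t : supp_meets A U_(t)%MM <-> A t.
Proof.
split=> [[s As]|At]; last by exists t => //; rewrite mnm1E eqxx.
by rewrite mnm1E; case: (t =P s) => [->|].
Qed.

Definition var_ideal A : set S := monomial_ideal (supp_meets A).

Lemma var_idealP A : is_ideal (var_ideal A).
Proof. exact/monomial_idealP/supp_meets_up. Qed.

Lemma var_idealX A t : var_ideal A 'X_t <-> A t.
Proof. by rewrite /var_ideal monomial_idealX supp_meetsU. Qed.

Lemma var_idealS A B : (forall t, A t -> B t) -> var_ideal A `<=` var_ideal B.
Proof. by move=> AB f If m /If [t At mt]; exists t => //; apply: AB. Qed.

Lemma var_ideal_gen A : var_ideal A = ideal_gen [set 'X_t | t in [set` A]].
Proof.
apply/seteqP; split.
  apply: monomial_ideal_min; first exact: ideal_genP.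
  move=> m [t At mt]; have mE : (m - U_(t) + U_(t) = m)%MM by apply: submK; rewrite lep1mP.
  rewrite -mE mpolyXD; apply: (ideal_mull _ (ideal_genP _)).
  by apply: ideal_gen_sub; exists t.
apply: ideal_gen_min; first exact: var_idealP.
by move=> _ [t At <-]; apply/var_idealX.
Qed.

(** Substituting zero for the variables in [A] is an endomorphism of a domain, and its kernel is
    [var_ideal A], which is therefore prime. *)
Let zap A f : S := f \mPo [tuple if A t then 0 else 'X_t | t < n].

Lemma zapX A m : zap A 'X_[m] = if `[< supp_meets A m >] then 0 else 'X_[m].
Proof.
rewrite /zap comp_mpolyX; case: asboolP => [[t At mt]|nA].
  by rewrite (bigD1 t) //= tnth_mktuple At expr0n (negPf mt) mul0r.
rewrite [RHS]mpolyXE_id; apply: eq_bigr => t _; rewrite tnth_mktuple.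
case: ifP => // At; have -> : m t = 0%N by apply/eqP/contraT => mt; case: nA; exists t.
by rewrite !expr0.
Qed.

Lemma mcoeff_zap A f m :
  (zap A f)@_m = if `[< supp_meets A m >] then 0 else f@_m.
Proof.
rewrite {1}(mpolyE f) /zap [X in X@_m]raddf_sum /= [LHS]raddf_sum /=.
have -> : f@_m = \sum_(m' <- msupp f) f@_m' * (m' == m)%:R.
  by rewrite {1}(mpolyE f) raddf_sum; apply: eq_bigr => i _; rewrite /= mcoeffZ mcoeffX.
rewrite (_ : (if _ then _ else _) = \sum_(m' <- msupp f)
  if `[< supp_meets A m >] then 0 else f@_m' * (m' == m)%:R); last first.
  by case: asboolP; rewrite ?big1_eq.
apply: eq_bigr => m' _; rewrite comp_mpolyZ -/(zap A _) zapX mcoeffZ.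
case: eqVneq => [->|mm']; first by case: asboolP => _; rewrite ?mcoeff0 ?mcoeffX ?eqxx ?mulr0.
by rewrite [LHS](_ : _ = 0) ?mulr0 ?if_same //; case: asboolP; rewrite ?mcoeff0 ?mcoeffX ?(negPf mm') ?mulr0.
Qed.

Lemma var_ideal_zap A f : var_ideal A f <-> zap A f = 0.
Proof.
split=> [If|/mpolyP f0 m].
  apply/mpolyP => m; rewrite mcoeff_zap mcoeff0; case: asboolP => // nA.
  by apply/eqP; rewrite mcoeff_eq0; apply/negP => /If.
rewrite mcoeff_msupp => fm; apply: contrapT => nA; move: (f0 m) fm.
by rewrite mcoeff_zap mcoeff0; case: asboolP => // _ ->; rewrite eqxx.
Qed.

Lemma var_ideal_prime A : is_prime (var_ideal A).
Proof.
split; first exact: var_idealP.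
- by move/var_ideal_zap/eqP; rewrite /zap rmorph1 oner_eq0.
- move=> f g /var_ideal_zap /eqP; rewrite /zap rmorphM mulf_eq0.
  by case/orP => /eqP /var_ideal_zap; [left|right].
Qed.

Lemma var_idealT f : var_ideal predT f <-> f@_0%MM = 0.
Proof.
split=> [If|f0 m].
  by apply/eqP; rewrite mcoeff_eq0; apply/negP => /If [t _]; rewrite mnm0E.
rewrite mcoeff_msupp => fm; apply: contrapT => nm; case/negP: fm; apply/eqP.
rewrite -f0; congr (f@_(_)); apply/mnmP => t; rewrite mnm0E; apply/eqP/contraT => mt.
by case: nm; exists t.
Qed.

Lemma monomial_ideal_mul U V (I J : set S) : is_ideal I -> is_ideal J ->
  I `<=` monomial_ideal U -> J `<=` monomial_ideal V ->
  (forall m, U m -> I 'X_[m]) -> (forall m, V m -> J 'X_[m]) ->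
  ideal_mul I J `<=` monomial_ideal [set m | ideal_mul I J 'X_[m]].
Proof.
move=> iI iJ IU JV UI VJ; apply: ideal_gen_min.
  apply: monomial_idealP => m m' /= h; rewrite mpolyXD mulrC.
  exact: (ideal_mull _ (ideal_genP _)) h.
move=> _ [f [g [If Jg ->]]] m /msuppM_le /allpairsP [[m1 m2] /= [h1 h2 ->]].
apply: ideal_gen_sub; exists 'X_[m1], 'X_[m2]; rewrite mpolyXD; split => //.
  by apply: UI; apply: IU h1.
by apply: VJ; apply: JV h2.
Qed.

(** The monomials of a product are products of monomials of the factors. Membership of a polynomial
    in a power thus passes to each of its monomials. *)
Lemma monomial_ideal_pow U p : up_closed U ->
  ideal_pow (monomial_ideal U) p `<=`
  monomial_ideal [set m | ideal_pow (monomial_ideal U) p 'X_[m]].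
Proof.
move=> Uup; elim: p => [|p IH] //=.
apply: (monomial_ideal_mul (U := U)) IH _ _ => //.
- exact: monomial_idealP.
- exact: ideal_powP.
- by move=> m /monomial_idealX.
Qed.

Definition weight (lam : 'I_n -> nat) (m : 'X_{1..n}) := (\sum_t lam t * m t)%N.

Lemma weightD lam m m' : weight lam (m + m')%MM = (weight lam m + weight lam m')%N.
Proof.
by rewrite /weight -big_split; apply: eq_bigr => t _; rewrite mnmDE mulnDr.
Qed.

Lemma weightMn lam m p : weight lam (m *+ p)%MM = (weight lam m * p)%N.
Proof.
by rewrite /weight big_distrl; apply: eq_bigr => t _; rewrite mulmnE mulnA.
Qed.

Lemma weightU lam t : weight lam U_(t)%MM = lam t.
Proof.
rewrite /weight (bigD1 t) //= mnm1E eqxx muln1 big1 ?addn0 // => s /negPf st.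
by rewrite mnm1E eq_sym st muln0.
Qed.

(** Weights are additive on products of monomials. A monomial of weight below [c * p] is thereby
    certified to lie outside the power. *)
Lemma weight_pow lam c U p m : (forall u, U u -> (c <= weight lam u)%N) ->
  ideal_pow (monomial_ideal U) p 'X_[m] -> (c * p <= weight lam m)%N.
Proof.
move=> Uc.
pose F p := monomial_ideal [set m | (c * p <= weight lam m)%N].
move=> Ip; suff /monomial_idealX : F p 'X_[m] by [].
move: Ip; apply: ideal_pow_min.
- move=> q; apply: monomial_idealP => u v /= h; rewrite weightD.
  exact: leq_trans h (leq_addr _ _).
- by apply/seteqP; split => // f _ u _ /=; rewrite muln0.
- move=> q f g If Fg u /msuppM_le /allpairsP [[m1 m2] /= [/If /Uc h1 /Fg /= h2 ->]].
  by rewrite weightD mulnS; apply: leq_add.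
Qed.

End MonomialIdeals.

(** * Powers of graph ideals *)

Section GraphIdeals.
Variables (k : fieldType) (n : nat) (G : simple_graph n).
Local Notation S := {mpoly k[n]}.
Local Notation I := (graph_ideal k G).

Definition off (i j : 'I_n) : pred 'I_n := [pred t | (t != i) && (t != j)].

Lemma pair_primeE i j : pair_prime k i j = var_ideal (off i j).
Proof.
rewrite var_ideal_gen; congr ideal_gen; congr image.
by apply/seteqP; split => t /= => [[ti tj]|/andP //]; apply/andP.
Qed.

Definition graph_monomials : set 'X_{1..n} :=
  [set m | forall i j, edge G i j -> supp_meets (off i j) m].

Lemma graph_idealE : I = monomial_ideal (k := k) graph_monomials.
Proof.
apply/seteqP; split=> [f If m fm i j eij|f If [i j] /= eij].
  by have := If (i, j) eij; rewrite pair_primeE; apply.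
by rewrite pair_primeE => m fm; apply: If eij.
Qed.

Lemma graph_monomials_up : up_closed graph_monomials.
Proof. by move=> m m' Um i j eij; apply: supp_meets_up; apply: Um. Qed.

Lemma graph_ideal_ideal : is_ideal I.
Proof. by rewrite graph_idealE; apply: monomial_idealP graph_monomials_up. Qed.

Lemma graph_idealX m : I 'X_[m] <-> graph_monomials m.
Proof. by rewrite graph_idealE monomial_idealX. Qed.

Lemma graph_pow_monomial p f m :
  ideal_pow I p f -> m \in msupp f -> ideal_pow I p 'X_[m].
Proof.
by rewrite graph_idealE => /(monomial_ideal_pow graph_monomials_up); apply.
Qed.

Lemma graph_pow_weight lam c p m :
  (forall u, graph_monomials u -> (c <= weight lam u)%N) ->
  ideal_pow I p 'X_[m] -> (c * p <= weight lam m)%N.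
Proof. by rewrite graph_idealE; apply: weight_pow. Qed.

Lemma edge_neq i j : edge G i j -> i != j.
Proof. by move=> eij; apply: contraTneq eij => ->; rewrite edge_irrefl. Qed.

(** The bound [p <= out_degree i j w] says that the monomial [w] lies in the [p]-th power of the
    prime of the pair. *)
Definition out_degree i j (w : 'X_{1..n}) := weight (fun t => off i j t) w.

(* The symbolic power condition at the pair [i, j] puts a monomial in the
   ordinary power once [x_i] and [x_j] are inverted. *)
Lemma graph_pow_localized p w i j : i != j ->
  (edge G i j -> (p <= out_degree i j w)%N) ->
  exists K, forall L, (K <= L)%N ->
    ideal_pow I p (('X_i * 'X_j) ^+ L * 'X_[w]).
Proof.
move=> ij hw; have iI := ideal_powP I p.
(* If the pair is not an edge, every edge misses [i] or [j], so [x_i x_j] itself lies in [I]. *)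
case: (boolP (edge G i j)) => [eij|nij]; last first.
  exists p => L pL; apply: ideal_mulr => //; rewrite -(subnK pL) exprD.
  apply: ideal_mull => //; apply: ideal_powX; rewrite -mpolyXD graph_idealX.
  move=> a b eab; have [ai|ai] := boolP (off a b i).
    by exists i => //; rewrite mnmDE mnm1E eqxx.
  have [bj|bj] := boolP (off a b j).
    by exists j => //; rewrite mnmDE !mnm1E eqxx addn1.
  move: ai bj; rewrite /= !negb_and !negbK.
  case/orP => /eqP ii; case/orP => /eqP jj; subst i j; move: ij nij.
  - by rewrite eqxx.
  - by rewrite eab.
  - by rewrite edge_sym eab.
  - by rewrite eqxx.
(* No edge contains three vertices, so [x_i x_j x_t] lies in [I] for each [t] off the edge. One
   factor [x_i x_j] is spent on each variable of [w] off the edge. *)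
exists (out_degree i j w) => L hL.
rewrite [X in _ * X]mpolyXE_id (bigID (off i j)) /= mulrA; apply: ideal_mulr => //.
rewrite -(subnK hL) exprD -mulrA; apply: ideal_mull => //.
apply: (ideal_powW (hw eij)).
have -> : out_degree i j w = (\sum_(t | off i j t) w t)%N.
  rewrite /out_degree /weight (bigID (off i j)) /= [X in (_ + X)%N]big1 ?addn0.
    by apply: eq_bigr => t ->; rewrite mul1n.
  by move=> t /negPf ->.
apply: (big_rec2 (fun a b => ideal_pow I a (('X_i * 'X_j) ^+ a * b))).
  by rewrite expr0 mulr1.
move=> t a b hoff hab; rewrite exprD.
have -> : ('X_i * 'X_j) ^+ w t * ('X_i * 'X_j) ^+ a * ('X_t ^+ w t * b) =
    ('X_i * 'X_j * 'X_t) ^+ w t * (('X_i * 'X_j) ^+ a * b) :> S.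
    by rewrite [in RHS]exprMn mulrACA.
apply: ideal_powD => //; apply: ideal_powX.
have [ti tj] := andP hoff.
rewrite -!mpolyXD graph_idealX => c d ecd.
have [ci|ci] := boolP (off c d i).
  by exists i => //; rewrite !mnmDE mnm1E eqxx.
have [cj|cj] := boolP (off c d j).
  by exists j => //; rewrite !mnmDE !mnm1E eqxx addnAC addn1.
have [ct|ct] := boolP (off c d t).
  by exists t => //; rewrite !mnmDE !mnm1E eqxx addn1.
move: ci cj ct ij ti tj; rewrite /= !negb_and !negbK.
case/orP => /eqP->; case/orP => /eqP->; case/orP=> /eqP ->; rewrite ?eqxx //.
Qed.

(* The two vanishing conditions on local cohomology, in elementary terms. *)
Variable p : nat.
Hypothesis torsion_free : forall N (v : S),
  (forall i, ideal_pow I p ('X_i ^+ N * v)) -> ideal_pow I p v.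
Hypothesis extension : forall N (u : 'I_n -> S),
  (forall i j, ideal_pow I p ('X_i ^+ N * u j - 'X_j ^+ N * u i)) ->
  exists v, forall i, ideal_pow I p ('X_i ^+ N * v - u i).

Lemma graph_pow_symbolic w :
  (forall i j, edge G i j -> (p <= out_degree i j w)%N) ->
  ideal_pow I p 'X_[w].
Proof.
move=> hw; have iI := ideal_powP I p.
have [K hK] : exists K, forall i j, i != j ->
    ideal_pow I p (('X_i * 'X_j) ^+ K * 'X_[w]).
  have /choice [K hK] : forall ij : 'I_n * 'I_n, exists K, ij.1 != ij.2 ->
      forall L, (K <= L)%N -> ideal_pow I p (('X_ij.1 * 'X_ij.2) ^+ L * 'X_[w]).
    move=> [i j] /=; case: (eqVneq i j) => [_|ij]; first by exists 0%N.
    by have [K hK] := graph_pow_localized ij (hw i j); exists K.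
  exists (\max_ij K ij)%N => i j ij; apply: (hK (i, j)) => //.
  exact: (leq_bigmax (i, j)).
(* It remains to place [x_i ^ K w] in the power for each [i]. The exponent [N] exceeds that of [x_i]
   in this monomial, so the monomial cannot occur in a multiple of [x_i ^ N] and must survive in the
   difference given by [extension]. *)
apply: (torsion_free (N := K)) => i.
pose N := (K + (w i).+1)%N.
have wI b : b != i -> ideal_pow I p ('X_b ^+ N * ('X_i ^+ K * 'X_[w])).
  move=> bi; have -> : 'X_b ^+ N * ('X_i ^+ K * 'X_[w]) =
      'X_b ^+ (w i).+1 * (('X_i * 'X_b) ^+ K * 'X_[w]) :> S.
    by rewrite exprMn /N exprD; ring.
  by apply: ideal_mull => //; apply: hK; rewrite eq_sym.
have [a b|v /(_ i)] := extension (N := N)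
    (u := fun j => if j == i then 'X_i ^+ K * 'X_[w] else 0).
  have [->|ai] := eqVneq a i; have [->|bi] := eqVneq b i.
  - by rewrite subrr; apply: ideal0.
  - by rewrite mulr0 sub0r; apply: idealN => //; apply: wI.
  - by rewrite mulr0 subr0; apply: wI.
  - by rewrite !mulr0 subrr; apply: ideal0.
rewrite eqxx !mpolyXn -mpolyXD => /graph_pow_monomial; apply.
rewrite mcoeff_msupp mcoeffB mcoeffX eqxx.
rewrite (_ : (_ * v)@_ _ = 0) ?sub0r ?oppr_eq0 ?oner_eq0 //.
apply/eqP; rewrite mcoeff_eq0; apply/negP => /msuppM_le /allpairsP.
move=> [[m1 m2] /= []]; rewrite msuppX mem_seq1 => /eqP -> _ /mnmP /(_ i).
by rewrite !mnmDE !mulmnE !mnm1E eqxx /N; lia.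
Qed.

Lemma graph_pow_certificate lam c w :
  (forall i j, edge G i j -> (p <= out_degree i j w)%N) ->
  (forall u, graph_monomials u -> (c <= weight lam u)%N) ->
  (c * p <= weight lam w)%N.
Proof. by move=> /graph_pow_symbolic h1 h2; apply: graph_pow_weight h1. Qed.

(* The degree complex of [x_a ^ (p - 1) x_d ^ (p - 1)] has the two disjoint
   edges [ab] and [cd] as its facets, so it is disconnected. *)
Lemma graph_pow_connected a b c d : (2 <= p)%N -> uniq [:: a; b; c; d] ->
  (forall i, i \in [:: a; b; c; d]) ->
  edge G a b -> edge G c d ->
  ~~ edge G a c -> ~~ edge G b d -> ~~ edge G a d -> False.
Proof.
move=> hp + cov eab ecd nac nbd nad.
rewrite /= !inE !negb_or => /and4P[/and3P[ab ac ad] /andP[bc bd] cd _].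
have iI := ideal_powP I p; have pp : (p.-1 < p)%N by case: (p) hp.
pose w := ((U_(a) + U_(d)) *+ p.-1)%MM.
have odE i j : out_degree i j w = ((off i j a + off i j d) * p.-1)%N.
  by rewrite /out_degree weightMn weightD !weightU.
have cross i j : i \in [:: a; b] -> j \in [:: c; d] -> exists K, forall L,
    (K <= L)%N -> ideal_pow I p (('X_i * 'X_j) ^+ L * 'X_[w]).
  move=> iab jcd; apply: graph_pow_localized.
    apply: contraTneq jcd => <-; move: iab; rewrite !inE.
    by case/orP => /eqP ->; rewrite negb_or ?ac ?ad ?bc ?bd.
  move: iab jcd; rewrite !inE.
  case/orP => /eqP ->; case/orP => /eqP -> eij; move: eij nac nbd nad.
  - by move=> ->.
  - by move=> ->.
  (* Only the pair [b c] may be an edge. There [w] has out-degree [2 * (p - 1)], which is at least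
     [p]. *)
  - by move=> _ _ _ _; rewrite odE /off /= ab ac [d == b]eq_sym bd [d == c]eq_sym cd; lia.
  - by move=> ->.
have [K hK] : exists K, forall i j, i \in [:: a; b] -> j \in [:: c; d] ->
    ideal_pow I p (('X_i * 'X_j) ^+ K * 'X_[w]).
  have /choice [K hK] : forall ij : 'I_n * 'I_n, exists K,
      ij.1 \in [:: a; b] -> ij.2 \in [:: c; d] ->
      forall L, (K <= L)%N -> ideal_pow I p (('X_ij.1 * 'X_ij.2) ^+ L * 'X_[w]).
    move=> [i j] /=; have [iab|] := boolP (i \in _); last by exists 0%N.
    have [jcd|] := boolP (j \in _); last by exists 0%N.
    by have [K hK] := cross i j iab jcd; exists K.
  exists (\max_ij K ij)%N => i j iab jcd; apply: (hK (i, j)) => //.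
  exact: (leq_bigmax (i, j)).
have part i : i \in [:: a; b] = (i \notin [:: c; d]).
  have := cov i; rewrite !inE.
  have [->|ia] := eqVneq i a; first by rewrite negb_or ac ad.
  have [->|ib] := eqVneq i b; first by rewrite negb_or bc bd.
  by move=> /= ->.
(* The section is [w] where [x_a] or [x_b] is invertible and zero where [x_c] or [x_d] is. The
   overlaps agree by [hK]. *)
have [i j|v hv] := extension (N := K)
    (u := fun i => if i \in [:: a; b] then 'X_i ^+ K * 'X_[w] else 0).
  have [iab|icd] := boolP (i \in [:: a; b]);
    have [jab|jcd] := boolP (j \in [:: a; b]).
  - by rewrite mulrCA subrr; apply: ideal0.
  - rewrite mulr0 sub0r; apply: idealN => //; rewrite mulrA -exprMn.
    by rewrite [X in X ^+ _]mulrC; apply: hK => //; rewrite part negbK in jcd.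
  - rewrite mulr0 subr0 mulrA -exprMn [X in X ^+ _]mulrC.
    by apply: hK => //; rewrite part negbK in icd.
  - by rewrite !mulr0 subrr; apply: ideal0.
(* Multiplying by [x_i ^ K] leaves the out-degree at an edge through [i] unchanged, hence still
   below [p]. So the coefficient of [w] in an extension [v] is forced to be one by [a] and zero by
   [d]. *)
have nI i j : out_degree i j w = p.-1 -> edge G i j ->
    ~ ideal_pow I p ('X_[U_(i) *+ K + w]).
  move=> oij eij /(graph_pow_weight (lam := fun t => off i j t) (c := 1)).
  rewrite weightD weightMn weightU mul1n -/(out_degree i j w) oij /off /= eqxx /=.
  rewrite mul0n add0n => h; move: pp; rewrite ltnNge => /negP; apply.
  apply: h => u /(_ i j eij) [t ot ut].
  rewrite /weight (bigD1 t) //=; move: ot; rewrite /off /= => ->; rewrite mul1n.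
  apply: leq_trans (leq_addr _ _).
  by rewrite lt0n.
have va : v@_w = 1.
  apply/eqP; rewrite -subr_eq0; apply: contraPT (hv a) => vw /=.
  rewrite !inE eqxx -mulrBr => /graph_pow_monomial h.
  apply: (nI a b) => //.
    by rewrite odE /off /= eqxx /= [d == a]eq_sym ad [d == b]eq_sym bd /= mul1n.
  apply: h; rewrite mcoeff_msupp mpolyXn mulrC mcoeffMX mcoeffB mcoeffX.
  by rewrite eqxx.
have vd : v@_w = 0.
  apply/eqP; apply: contraPT (hv d) => vw /=.
  rewrite part !inE eqxx orbT /= subr0 => /graph_pow_monomial h.
  apply: (nI d c); [|by rewrite edge_sym|].
    by rewrite odE /off /= eqxx /= ad ac addn0 mul1n.
  by apply: h; rewrite mcoeff_msupp mpolyXn mulrC mcoeffMX.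
by move: va; rewrite vd => /esym /eqP; rewrite oner_eq0.
Qed.

(** The pattern of the exclusions below: a monomial that passes the symbolic condition at every
    edge, yet is too light for the ordinary power. *)
Lemma graph_pow_gap lam c w :
  (forall i j, edge G i j -> (p <= out_degree i j w)%N) ->
  (forall u, graph_monomials u -> (c <= weight lam u)%N) ->
  (weight lam w < c * p)%N -> False.
Proof. by move=> h1 h2; rewrite ltnNge graph_pow_certificate. Qed.

Lemma weight_ge lam (s : seq 'I_n) (u : 'X_{1..n}) : uniq s ->
  (forall x, x \in s -> u x != 0%N) -> (\sum_(x <- s) lam x <= weight lam u)%N.
Proof.
move=> us hs; rewrite big_uniq //= /weight [leqRHS](bigID (mem s)) /=.
apply: leq_trans (leq_addr _ _); apply: leq_sum => x /hs ux.
by rewrite leq_pmulr // lt0n.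
Qed.

Lemma out_degree_sum (s : seq 'I_n) i j :
  out_degree i j (\sum_(x <- s) U_(x))%MM = count (off i j) s.
Proof.
elim: s => [|x s IH]; last by rewrite big_cons /out_degree weightD weightU -/(out_degree i j _) IH.
by rewrite big_nil /out_degree /weight big1 // => t _; rewrite mnm0E muln0.
Qed.

Lemma weight_sum lam (s : seq 'I_n) :
  weight lam (\sum_(x <- s) U_(x))%MM = (\sum_(x <- s) lam x)%N.
Proof.
elim: s => [|x s IH]; last by rewrite !big_cons weightD weightU IH.
by rewrite !big_nil /weight big1 // => t _; rewrite mnm0E muln0.
Qed.

Lemma count_off (s : seq 'I_n) i j : uniq s -> (size s <= count (off i j) s + 2)%N.
Proof.
move=> us; rewrite -(count_predC (off i j) s) leq_add2l -size_filter.
apply: (@uniq_leq_size _ _ [:: i; j]); first exact: filter_uniq.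
by move=> x; rewrite mem_filter /= negb_and !negbK !inE => /andP[].
Qed.

Lemma nonedge_off i j a b : edge G i j -> a != b -> ~~ edge G a b ->
  (0 < off i j a + off i j b)%N.
Proof.
move=> eij ab; apply: contraR; rewrite -leqNgt leqn0 addn_eq0 !eqb0 /off /=.
rewrite !negb_and !negbK => /andP[ha hb]; move: ab.
case/orP: ha => /eqP ->; case/orP: hb => /eqP ->.
- by rewrite eqxx.
- by rewrite eij.
- by rewrite edge_sym eij.
- by rewrite eqxx.
Qed.

Lemma graph_monomial_supp u x y : graph_monomials u -> edge G x y ->
  exists t, [/\ t != x, t != y & u t != 0%N].
Proof. by move=> hu /hu [t /andP[tx ty] ut]; exists t. Qed.

(** A variable dividing [u] lies on some edge, as no vertex is isolated, and that edge forces a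
    second variable into [u]. *)
Lemma graph_monomial_deg u : (0 < n)%N -> graph_monomials u ->
  (2 <= weight (fun=> 1%N) u)%N.
Proof.
move=> n0 hu; have [y exy] := edge_no_isolated G (Ordinal n0).
have [s [_ _ us]] := graph_monomial_supp hu exy.
have [t est] := edge_no_isolated G s.
have [r [rs _ ur]] := graph_monomial_supp hu est.
have := weight_ge (fun=> 1%N) (s := [:: r; s]) (u := u).
rewrite /= inE rs !big_cons big_nil /=; apply => // x; rewrite !inE.
by case/orP => /eqP ->.
Qed.

Let leq_add_mul c A B : (c <= A)%N -> (0 < B)%N -> (c <= p)%N ->
  (p <= A + B * (p - c))%N.
Proof. by move=> cA B0 cp; rewrite -{1}(subnKC cp) leq_add // leq_pmull. Qed.

(** * Configurations excluded by the vanishing conditions *)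

Hypothesis p3 : (3 <= p)%N.
Hypothesis n4 : (4 <= n)%N.

(** Take [x_t (x_a x_b x_c) ^ (p - 1)] with [t] a fourth vertex, and give weight 1 to the triangle
    and 2 to all other vertices. The weight is [3 * p - 1], while a monomial of [I] weighs at least
    3: it contains an outside variable and another one, or all of [a], [b], [c]. *)
Lemma graph_pow_triangle_free a b c :
  edge G a b -> edge G b c -> edge G a c -> False.
Proof.
move=> eab ebc eac.
have [[ab bc] ac] := (edge_neq eab, edge_neq ebc, edge_neq eac).
have uabc : uniq [:: a; b; c] by rewrite /= !inE negb_or ab ac bc.
have [t tabc] : exists t, t \notin [:: a; b; c].
  apply: contrapT => h; have : (#|'I_n| <= size [:: a; b; c])%N.
    rewrite cardE; apply: uniq_leq_size (enum_uniq _) _ => x _.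
    by apply: contraT => xn; case: h; exists x.
  by rewrite card_ord leqNgt n4.
pose lam x := if x \in [:: a; b; c] then 1%N else 2%N.
have lam1 x : (1 <= lam x)%N by rewrite /lam; case: ifP.
apply: (@graph_pow_gap lam 3 (\sum_(x <- [:: t; a; b; c]) U_(x) +
  (\sum_(x <- [:: a; b; c]) U_(x)) *+ (p - 2))%MM).
- move=> i j _; rewrite /out_degree weightD weightMn -!/(out_degree _ _ _).
  rewrite !out_degree_sum.
  have := count_off i j uabc; have := @count_off [:: t; a; b; c] i j.
  rewrite cons_uniq tabc uabc => /(_ isT); rewrite !addn2 !ltnS => hA hB.
  by apply: leq_add_mul => //; apply: ltnW.
- move=> u hu; have [[s [sabc us]]|h] :=
    pselect (exists s, s \notin [:: a; b; c] /\ u s != 0%N).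
    have [s' ess] := edge_no_isolated G s.
    have [r [rs _ ur]] := graph_monomial_supp hu ess.
    have := @weight_ge lam [:: r; s] u.
    rewrite /= inE rs !big_cons big_nil /= addn0 => /(_ isT) h.
    apply: leq_trans (h _); last by move=> x; rewrite !inE => /orP[]/eqP ->.
    by rewrite [lam s]/lam (negPf sabc) addn2 !ltnS.
  have inabc s : u s != 0%N -> s \in [:: a; b; c].
    by move=> us; apply: contraT => sn; case: h; exists s.
  have := @weight_ge lam [:: a; b; c] u uabc.
  rewrite !big_cons big_nil /lam !inE !eqxx !orbT /=; apply.
  have [r1 [r1a r1b u1]] := graph_monomial_supp hu eab.
  have [r2 [r2b r2c u2]] := graph_monomial_supp hu ebc.
  have [r3 [r3a r3c u3]] := graph_monomial_supp hu eac.
  move: (inabc _ u1) (inabc _ u2) (inabc _ u3); rewrite !inE.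
  rewrite (negPf r1a) (negPf r1b) (negPf r2b) (negPf r2c) (negPf r3a) (negPf r3c).
  rewrite /= ?orbF => /eqP <- /eqP <- /eqP <- x.
  by rewrite !inE; case/or3P => /eqP ->.
- rewrite weightD weightMn !weight_sum !big_cons !big_nil /lam (negPf tabc).
  by rewrite !inE !eqxx !orbT /=; lia.
Qed.

(** An edge contains at most one of the three vertices, so [x_a x_b x_c (x_a x_b) ^ (p - 2)] has
    out-degree at least [p] everywhere. Its degree is only [2 * p - 1]. *)
Lemma graph_pow_no_independent_triple a b c : uniq [:: a; b; c] ->
  ~~ edge G a b -> ~~ edge G b c -> ~~ edge G a c -> False.
Proof.
move=> uabc nab nbc nac.
have /and3P[/norP[ab ac] bc _] : [&& ~~ ((a == b) || (a == c)), b != c & true].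
  by move: uabc; rewrite /= !inE.
apply: (@graph_pow_gap (fun=> 1%N) 2 (U_(a) + U_(b) + U_(c) +
  (U_(a) + U_(b)) *+ (p - 2))%MM).
- move=> i j eij; rewrite /out_degree !(weightD, weightMn, weightU).
  have := nonedge_off eij ab nab; have := nonedge_off eij bc nbc.
  have := nonedge_off eij ac nac.
  move=> h1 h2 h3; apply: leq_add_mul (ltnW p3) => //.
  by move: h1 h2 h3; do 3!case: (off i j _).
- by move=> u; apply: graph_monomial_deg; apply: leq_trans n4.
- by rewrite !(weightD, weightMn, weightU); lia.
Qed.

(** An edge misses at least three of five vertices and at least one end of a non-edge [a b]. The
    product of five variables with [(x_a x_b) ^ (p - 3)] then has out-degree at least [p], but
    degree [2 * p - 1]. *)
Lemma graph_pow_four_vertices : n = 4.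
Proof.
apply/eqP; rewrite eqn_leq n4 andbT leqNgt; apply/negP => n5.
pose v (i : nat) (hi : (i < 5)%N) : 'I_n := Ordinal (leq_trans hi n5).
pose s := [:: @v 0 isT; @v 1 isT; @v 2 isT; @v 3 isT; @v 4 isT].
have [a [b [ab nab]]] : exists a b, a != b /\ ~~ edge G a b.
  have [e01|] := boolP (edge G (@v 0 isT) (@v 1 isT)); last first.
    by exists (@v 0 isT), (@v 1 isT).
  have [e12|] := boolP (edge G (@v 1 isT) (@v 2 isT)); last first.
    by exists (@v 1 isT), (@v 2 isT).
  have [e02|] := boolP (edge G (@v 0 isT) (@v 2 isT)); last first.
    by exists (@v 0 isT), (@v 2 isT).
  by case: (graph_pow_triangle_free e01 e12 e02).
apply: (@graph_pow_gap (fun=> 1%N) 2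
  (\sum_(x <- s) U_(x) + (U_(a) + U_(b)) *+ (p - 3))%MM).
- move=> i j eij; rewrite /out_degree !(weightD, weightMn, weightU).
  rewrite -/(out_degree i j _) out_degree_sum.
  have := @count_off s i j isT; rewrite [size s]/=; move: (count _ s) => C h.
  have := nonedge_off eij ab nab.
  by move=> h3; apply: leq_add_mul => //; rewrite addn2 !ltnS in h.
- by move=> u; apply: graph_monomial_deg; apply: leq_trans n4.
- rewrite !(weightD, weightMn, weightU) weight_sum !big_cons big_nil.
  by lia.
Qed.

Lemma cycle4 a b c d : uniq [:: a; b; c; d] -> (forall i, i \in [:: a; b; c; d]) ->
  edge G a b -> edge G b c -> edge G c d -> edge G d a ->
  is_cycle_of_length G 4.
Proof.
move=> us cov eab ebc ecd eda; exists [:: a; b; c; d]; split => // i j.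
have nac : edge G a c = false.
  by apply/negP => eac; case: (graph_pow_triangle_free eab ebc eac).
have nbd : edge G b d = false.
  by apply/negP => ebd; case: (graph_pow_triangle_free ebc ecd ebd).
have [eba ecb edc ead] : [/\ edge G b a, edge G c b, edge G d c & edge G a d].
  by rewrite edge_sym eab edge_sym ebc edge_sym ecd edge_sym eda.
have [nca ndb] : edge G c a = false /\ edge G d b = false.
  by rewrite edge_sym nac edge_sym nbd.
move: us; rewrite /= !inE !negb_or => /and4P[/and3P[ab ac ad] /andP[bc bd] cd _].
have [ba ca da] : [/\ b != a, c != a & d != a] by split; rewrite eq_sym.
have [cb db dc] : [/\ c != b, d != b & d != c] by split; rewrite eq_sym.
have := cov i; have := cov j; rewrite !inE.
by case/or4P => /eqP ->; case/or4P => /eqP ->; rewrite ?edge_irrefl;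
  rewrite ?(eab, ebc, ecd, eda, eba, ecb, edc, ead, nac, nbd, nca, ndb);
  rewrite ?(eqxx, negPf ab, negPf ac, negPf ad, negPf bc, negPf bd, negPf cd,
    negPf ba, negPf ca, negPf da, negPf cb, negPf db, negPf dc).
Qed.

Local Ltac permute :=
  apply/permP; let P := fresh in intro P; simpl;
  do 4 (case: (P _)); reflexivity.

Lemma graph_pow_cycle4 : is_cycle_of_length G 4.
Proof.
have n_eq := graph_pow_four_vertices.
have [b eab] := edge_no_isolated G (Ordinal (leq_trans (isT : 0 < 4) n4)%N).
move: eab; set a := Ordinal _ => eab; have ab := edge_neq eab.
have [c [d [us cov]]] : exists c d, uniq [:: a; b; c; d] /\
    forall i, i \in [:: a; b; c; d].
  pose s := [seq x <- enum 'I_n | x \notin [:: a; b]].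
  have us : uniq s by rewrite filter_uniq ?enum_uniq.
  have ms x : x \in s = (x \notin [:: a; b]) by rewrite mem_filter mem_enum andbT.
  have uabs : uniq [:: a, b & s] by rewrite /= us !(inE, ms) !eqxx orbT /= orbF ab.
  have ss : size s = 2.
    have : size [:: a, b & s] = size (enum 'I_n).
      apply/perm_size/uniq_perm; rewrite ?enum_uniq // => x.
      by rewrite mem_enum !(inE, ms); case: (x == a); case: (x == b).
    by rewrite -cardE card_ord => h; case: (etrans h n_eq).
  case: s ss us ms uabs => [//|c [//|d [|//]]] _ _ ms us; exists c, d.
  by split=> // i; have := ms i; rewrite !inE; case: (i == a); case: (i == b).
have perm (s : seq 'I_n) : perm_eq [:: a; b; c; d] s ->
    uniq s /\ forall i, i \in s.
  by move=> h; rewrite -(perm_uniq h); split => // i; rewrite -(perm_mem h).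
have conn x y z w : perm_eq [:: a; b; c; d] [:: x; y; z; w] ->
    edge G x y -> edge G z w -> edge G x z = false -> edge G y w = false ->
    edge G x w = false -> False.
  move=> /perm [u cv] e1 e2 /negbT n1 /negbT n2 /negbT n3.
  exact: (graph_pow_connected (ltnW p3) u cv e1 e2 n1 n2 n3).
have cyc x y z w : perm_eq [:: a; b; c; d] [:: x; y; z; w] ->
    edge G x y -> edge G y z -> edge G z w -> edge G w x ->
    is_cycle_of_length G 4.
  by move=> /perm [u cv]; apply: cycle4.
have tri x y z : edge G x y -> edge G y z -> edge G x z = false.
  by move=> e1 e2; apply/negP => e3; apply: graph_pow_triangle_free e1 e2 e3.
have ind x y z : uniq [:: x; y; z] -> edge G x y = false -> edge G y z = false ->
    edge G x z.
  move=> u /negbT e1 /negbT e2; apply: contraT => e3.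
  by case: (graph_pow_no_independent_triple u e1 e2 e3).
have [uacd ubcd] : uniq [:: a; c; d] /\ uniq [:: b; c; d].
  by move: us; rewrite /= !inE !negb_or => /and4P[/and3P[_ -> ->] /andP[-> ->] -> _].
have eba : edge G b a by rewrite edge_sym.
(* With [a b] and [c d] both edges, each remaining case is a four-cycle or, excluded by [conn], a
   path or two disjoint edges. *)
have [ecd|/negbTE ncd] := boolP (edge G c d).
  have edc : edge G d c by rewrite edge_sym.
  have [eac|/negbTE nac] := boolP (edge G a c).
    have [ebd|/negbTE nbd] := boolP (edge G b d).
      by apply: (cyc a c d b) => //; [permute|rewrite edge_sym].
    case: (conn b a c d) => //; first by permute.
    - exact: tri eba eac.
    - exact: tri eac ecd.
  have [ebd|/negbTE nbd] := boolP (edge G b d).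
    case: (conn a b d c) => //; first by permute.
    - exact: tri eab ebd.
    - exact: tri ebd edc.
  have [ead|/negbTE nad] := boolP (edge G a d); last first.
    by case: (conn a b c d) => //; permute.
  have [ebc|/negbTE nbc] := boolP (edge G b c).
    by apply: (cyc a d c b) => //; [permute|rewrite edge_sym].
  by case: (conn b a d c) => //; permute.
(* If [c d] is not an edge, the absence of triangles and of independent triples leaves a path on the
   four vertices, which [conn] excludes. *)
have ndc : edge G d c = false by rewrite edge_sym.
have [eac|/negbTE nac] := boolP (edge G a c).
  have ebd : edge G b d by apply: ind ubcd (tri _ _ _ eba eac) ncd.
  case: (conn c a b d) => //; first by permute.
  - by rewrite edge_sym.
  - by rewrite edge_sym; apply: tri eba eac.
  - exact: tri eab ebd.
have ead : edge G a d by apply: ind uacd nac ncd.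
have nbd : edge G b d = false by apply: tri eba ead.
have ebc : edge G b c.
  apply: contraFT ncd => nbc; have := ind b c d ubcd (negbTE nbc).
  by case: (edge G c d) => // /(_ erefl); rewrite nbd.
case: (conn d a b c) => //; first by permute.
- by rewrite edge_sym.
- by rewrite edge_sym.
Qed.

End GraphIdeals.

(** * From Cohen-Macaulayness to the four-cycle *)

Section Quotient.
Variables (S R : comNzRingType) (pi : {rmorphism S -> R}).
Hypothesis pi_surj : forall r, exists f, pi f = r.
Implicit Types (P Q M : set S).

Lemma image_idealP P : is_ideal P -> is_ideal (pi @` P).
Proof.
move=> iP; split=> [|_ _ [f Pf <-] [g Pg <-]|r _ [f Pf <-]].
- by exists 0; [exact: ideal0|rewrite rmorph0].
- by exists (f + g); [exact: idealD|rewrite rmorphD].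
- have [g <-] := pi_surj r.
  by exists (g * f); [exact: ideal_mull|rewrite rmorphM].
Qed.

Lemma preimage_idealP (P : set R) : is_ideal P -> is_ideal (pi @^-1` P).
Proof.
move=> iP; split=> [|f g|f g]; rewrite /preimage /= ?rmorph0 ?rmorphD ?rmorphM.
- exact: ideal0.
- exact: idealD.
- exact: ideal_mull.
Qed.

Lemma image_idealE P f : is_ideal P -> (forall g, pi g = 0 -> P g) ->
  (pi @` P) (pi f) <-> P f.
Proof.
move=> iP kP; split=> [[g Pg gf]|Pf]; last by exists f.
apply: (ideal_transfer iP _ Pg); apply: kP.
by rewrite rmorphB gf subrr.
Qed.

Lemma image_prime P : is_prime P -> (forall g, pi g = 0 -> P g) ->
  is_prime (pi @` P).
Proof.
move=> [iP P1 pP] kP; split; first exact: image_idealP.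
  by rewrite -(rmorph1 pi) image_idealE.
move=> r s; have [f <-] := pi_surj r; have [g <-] := pi_surj s.
by rewrite -rmorphM !image_idealE //; apply: pP.
Qed.

Lemma image_maximal M : is_maximal M -> (forall g, pi g = 0 -> M g) ->
  is_maximal (pi @` M).
Proof.
move=> [iM M1 maxM] kM; split; first exact: image_idealP.
  by rewrite -(rmorph1 pi) image_idealE.
move=> J iJ MJ J1.
have /(_ _ _ _)/esym := maxM (pi @^-1` J).
move=> -> //; [|exact: preimage_idealP|by move=> f Mf; apply: MJ; exists f|].
  apply/seteqP; split=> [r Jr|_ [f Jf <-] //].
  by have [f fr] := pi_surj r; exists f; rewrite /preimage /= fr.
by rewrite /preimage /= rmorph1.
Qed.

End Quotient.

(** * Height and local cohomology at the origin *)

Section GradedMaximal.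
Variables (k : fieldType) (n : nat).
Local Notation S := {mpoly k[n]}.

Lemma var_ideal_maximal : is_maximal (var_ideal (k := k) (n := n) predT).
Proof.
split; first exact: var_idealP.
  by move/var_idealT/eqP; rewrite mcoeff1 eqxx oner_eq0.
move=> J iJ MJ J1; apply/seteqP; split=> // f Jf; apply/var_idealT/eqP.
apply: contra_notT J1 => f0.
have Jc : J (f@_0%MM)%:MP.
  apply: (ideal_transfer iJ _ Jf); apply: MJ; apply/var_idealT.
  by rewrite mcoeffB mcoeffC eqxx mulr1 subrr.
have -> : 1 = ((f@_0%MM)^-1)%:MP * (f@_0%MM)%:MP :> S.
  by rewrite -mpolyCM mulVf.
exact: ideal_mull.
Qed.

Lemma var_idealT_range f : var_ideal (k := k) (n := n) predT f ->
  ideal_gen (range (fun t => 'X_t)) f.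
Proof. by rewrite var_ideal_gen; congr (ideal_gen _ _); congr image; apply/seteqP. Qed.

(** The kernel lies in the prime of the pair [i], [j], so a chain of three primes of variables
    descends to the quotient and ends at the origin. The height there is at least two, and so is the
    depth; the first two terms of a regular sequence give both conclusions. *)
Lemma cohen_macaulay_vanishing (R : comNzRingType) (pi : {rmorphism S -> R})
    (i j : 'I_n) : i != j ->
  (forall r, exists f, pi f = r) ->
  (forall f, pi f = 0 -> var_ideal [pred t | (t != i) && (t != j)] f) ->
  cohen_macaulay R ->
  (forall N (v : S), (forall t, pi ('X_t ^+ N * v) = 0) -> pi v = 0) /\
  (forall N (u : 'I_n -> S),
    (forall s t, pi ('X_s ^+ N * u t - 'X_t ^+ N * u s) = 0) ->
    exists v, forall t, pi ('X_t ^+ N * v - u t) = 0).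
Proof.
move=> ij surj ker [_ cm].
(* The chain adjoins first [x_i] and then [x_j] to the prime of the pair. *)
pose A (l : nat) : pred 'I_n := match l with
  | 0 => [pred t | (t != i) && (t != j)] | 1 => [pred t | t != j] | _ => predT end.
have A0 l t : A 0%N t -> A l t by case: l => [|[|l]] //= /andP[].
have kA l f : pi f = 0 -> var_ideal (A l) f by move=> /ker; exact: (@var_idealS k n _ _ (fun t => @A0 l t)).
pose M := pi @` var_ideal (k := k) (A 2).
have [d [[_ hd] [[s [rs sM sd]] _]]] := cm M (image_maximal surj var_ideal_maximal (kA 2%N)).
have d2 : (2 <= d)%N.
  apply: hd; exists (fun l => pi @` var_ideal (A l)); split=> //.
    by move=> l _; apply: image_prime (kA l) => //; apply: var_ideal_prime.
  move=> l l2; split.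
    by apply: image_subset; apply: var_idealS; move=> t; case: l l2 => [|[|]] //= _ /andP[].
  have [t At nAt] : exists2 t, A l.+1 t & ~~ A l t.
    case: l l2 => [|[|]] // _; first by exists i; rewrite //= eqxx.
    by exists j; rewrite //= eqxx.
  have iA q : is_ideal (var_ideal (k := k) (A q)) by apply: var_idealP.
  have Xt : var_ideal (k := k) (A l.+1) 'X_t by apply/var_idealX.
  move=> e; have := (image_idealE 'X_t (iA _) (kA l.+1)).2 Xt.
  by rewrite -e => /(image_idealE 'X_t (iA l) (kA l))/var_idealX; apply/negP.
have x_range r : M r -> ideal_gen (range (fun t : 'I_n => pi 'X_t)) r.
  move=> [f /var_idealT_range /ideal_gen_rangeP [c ->] <-].
  apply/ideal_gen_rangeP; exists (fun t => pi (c t)).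
  by rewrite rmorph_sum; apply: eq_bigr => t _; rewrite rmorphM.
move: d2; rewrite -sd; case: s rs sM {sd} => [|a [|b s]] // [rs _] sM _.
have ra w : a * w = 0 -> w = 0.
  have := rs 0%N isT w; rewrite /= => h aw.
  have /h /ideal_gen_seqP [c ->] : ideal_gen [set` [::]] (a * w).
    by rewrite aw; apply: ideal0; apply: ideal_genP.
  by rewrite big_ord0.
have gen1 w : ideal_gen [set` [:: a]] w <-> principal a w.
  rewrite ideal_gen_seqP; split=> [[c ->]|[c ->]].
    by exists (c 0%N); rewrite big_ord1.
  by exists (fun=> c); rewrite big_ord1.
have rb w : principal a (b * w) -> principal a w.
  by have := rs 1%N isT w; move=> /= h /gen1/h/gen1.
have Ma : M a by apply: sM => /=; rewrite inE eqxx.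
have Mb : M b by apply: sM => /=; rewrite !inE eqxx orbT.
split=> [N v h|N u h].
  apply: (regular_torsion_free ra (x_range a Ma) (N := N)) => t.
  by rewrite -rmorphXn -rmorphM h.
have [t t'|r hr] := regular_extension (x := fun t => pi 'X_t) (u := fun t => pi (u t))
    (N := N) ra rb (x_range a Ma) (x_range b Mb).
  by apply/eqP; rewrite -!rmorphXn -!rmorphM -subr_eq0 -rmorphB h.
have [v vr] := surj r; exists v => t.
by rewrite rmorphB rmorphM rmorphXn vr hr subrr.
Qed.

End GradedMaximal.

Local Open Scope quotient_scope.

Section IdealQuotient.
Variables (S : comNzRingType) (J : idealr S).

Lemma ideal_quot_eq0 f : (\pi_({ideal_quot J}) f == 0) = (f \in J).
Proof. by rewrite -[f in RHS]subr0 Quotient.idealrBE rmorph0. Qed.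

Lemma ideal_quot_surj (r : {ideal_quot J}) : exists f, \pi_({ideal_quot J}) f = r.
Proof. by exists (repr r); rewrite reprK. Qed.

End IdealQuotient.

Theorem cohen_macaulay_pow_cycle (k : fieldType) (n : nat) (G : simple_graph n) (m : nat) :
  (4 <= n)%N -> (3 <= m)%N ->
  cohen_macaulay_ideal (ideal_pow (graph_ideal k G) m) ->
  is_cycle_of_length G 4.
Proof.
move=> n4 m3 [J [JI cm]].
have JE f : f \in J <-> ideal_pow (graph_ideal k G) m f by rewrite -JI.
have [j eij] := edge_no_isolated G (Ordinal (leq_trans (isT : 0 < 4) n4)%N).
have pi0 f : \pi_({ideal_quot J}) f = 0 <-> ideal_pow (graph_ideal k G) m f.
  by rewrite -JE -ideal_quot_eq0; split=> [->|/eqP].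
have := @cohen_macaulay_vanishing k n {ideal_quot J} (\pi_({ideal_quot J})) _ _ (edge_neq eij).
case=> //.
- exact: ideal_quot_surj.
(* The kernel [I ^ m] lies in [I], hence in the prime of the chosen edge. *)
- move=> f /pi0 /(ideal_powW (ltnW (ltnW m3))) If.
  suff /(_ (_, _) eij) : graph_ideal k G f by rewrite pair_primeE.
  move: If => /=; apply: ideal_gen_min; first exact: graph_ideal_ideal.
  by move=> _ [a [b [Ia _ ->]]]; exact: (ideal_mulr _ (graph_ideal_ideal k G) Ia).
move=> h0 h1; apply: (@graph_pow_cycle4 k n G m) => // [N v h|N u h].
  by apply/pi0/(h0 N) => t; apply/pi0.
have [s t|v hv] := h1 N u; first exact/pi0.
by exists v => t; apply/pi0; apply: hv.
Qed.

(** * Hilbert's basis theorem *)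

Section Noetherian.

Lemma noetherian_field (k : fieldType) : noetherian k.
Proof.
move=> I iI; have [[x [Ix x0]]|I0] := pselect (exists x, I x /\ x != 0).
  exists [:: 1]; apply/seteqP; split=> [y _|y _].
    by rewrite -[y]mulr1; apply: (ideal_mull _ (ideal_genP _)); apply: ideal_gen_sub; rewrite /= inE.
  by rewrite -(mulfVK x0 y); apply: ideal_mull.
exists [::]; apply/seteqP; split=> [y Iy|y /ideal_gen_seqP [c ->]].
  have [->|y0] := eqVneq y 0; first exact: ideal0 (ideal_genP _).
  by case: I0; exists y.
by rewrite big_ord0; apply: ideal0.
Qed.

Lemma noetherian_surj (S R : comNzRingType) (pi : {rmorphism S -> R}) :
  (forall r, exists f, pi f = r) -> noetherian S -> noetherian R.
Proof.
move=> surj nS I iI; have [s sE] := nS _ (preimage_idealP pi iI).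
exists (map pi s); apply/seteqP; split.
  move=> r Ir; have [f fr] := surj r.
  have : (pi @^-1` I) f by rewrite /preimage /= fr.
  rewrite sE -fr => /(ideal_gen_min (preimage_idealP pi (ideal_genP [set` map pi s]))).
  by apply=> g gs; apply: ideal_gen_sub => /=; apply: map_f.
apply: ideal_gen_min => // _ /mapP [g gs ->].
have : ideal_gen [set` s] g by apply: ideal_gen_sub.
by rewrite -sE.
Qed.

Variable R : comNzRingType.
Hypothesis noethR : noetherian R.
Implicit Types (f g : {poly R}) (I : set {poly R}).

(** Multiples of the [F c] by [X ^ (e - D)] cancel the coefficient of [f] in degree [e]; this is the
    reduction step of Hilbert's argument. *)
Let cancel_coef I (s : seq R) (F : R -> {poly R}) (D e : nat) f : is_ideal I ->
  (forall c, c \in s -> [/\ I (F c), (size (F c) <= D.+1)%N & (F c)`_D = c]) ->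
  (D <= e)%N -> (size f <= e.+1)%N -> ideal_gen [set` s] f`_e ->
  exists g, [/\ ideal_gen [set` map F s] g, I g & (size (f - g)%R <= e)%N].
Proof.
move=> iI hF De fe /ideal_gen_seqP [c ce].
have hs (i : 'I_(size s)) : s`_i \in s by apply: mem_nth.
exists (\sum_(i < size s) (c i *: 'X^(e - D)) * F s`_i); split.
- apply: ideal_sum => [|i _]; first exact: ideal_genP.
  by apply: (ideal_mull _ (ideal_genP _)); apply: ideal_gen_sub => /=; apply: map_f.
- apply: ideal_sum => // i _; apply: ideal_mull => //.
  by have [] := hF _ (hs i).
- apply/leq_sizeP => j; rewrite leq_eqVlt => /predU1P [<-|ej].
    rewrite coefB coef_sum ce -sumrB big1 // => i _.
    rewrite -scalerAl coefZ coefXnM ltnNge leq_subr /= subKn //.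
    by have [_ _ ->] := hF _ (hs i); rewrite subrr.
  rewrite coefB coef_sum (leq_sizeP _ _ fe) // big1 ?subrr // => i _.
  rewrite -scalerAl coefZ coefXnM; have [_ sF _] := hF _ (hs i).
  case: ifP => _; first by rewrite mulr0.
  by rewrite (leq_sizeP _ _ sF) ?mulr0 //; lia.
Qed.

Lemma noetherian_poly : noetherian {poly R}.
Proof.
move=> I iI.
(* The ideal of coefficients in degree [d] of members of degree at most [d]. It grows with [d], and
   the union is generated within a single degree [D]. *)
pose Lead d c := exists f, [/\ I f, (size f <= d.+1)%N & f`_d = c].
have Leadz d : is_ideal [set c | Lead d c].
  split=> [|a b /= [f [If sf fa]] [g [Ig sg gb]]|a b /= [f [If sf fb]]].
  - by exists 0; split; [exact: ideal0|rewrite size_poly0|rewrite coef0].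
  - exists (f + g); split; [exact: idealD| |by rewrite coefD fa gb].
    by apply: leq_trans (size_polyD _ _) _; rewrite geq_max sf sg.
  - exists (a%:P * f); split; [exact: ideal_mull| |by rewrite coefCM fb].
    by rewrite mul_polyC; apply: leq_trans (size_scale_leq _ _) sf.
have LeadS d e c : (d <= e)%N -> Lead d c -> Lead e c.
  move=> de [f [If sf fc]]; exists ('X^(e - d) * f); split.
  - exact: ideal_mull.
  - apply/leq_sizeP => j ej; rewrite coefXnM; case: ifP => // _.
    by rewrite (leq_sizeP _ _ sf) //; lia.
  - by rewrite coefXnM ltnNge leq_subr /= subKn.
(* Members of degree below [D] escape the reduction by elements of degree [D], so they get their own
   finite set of generators, one degree at a time. *)
have low D : exists t : seq {poly R}, [set` t] `<=` I /\
    forall f, I f -> (size f <= D)%N -> ideal_gen [set` t] f.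
  elim: D => [|D [t [tI ht]]].
    exists [::]; split=> // f _; rewrite leqn0 size_poly_eq0 => /eqP ->.
    exact: ideal0 (ideal_genP _).
  have [s sE] := noethR (Leadz D).
  have /choice [F hF] : forall c, exists f, Lead D c ->
      [/\ I f, (size f <= D.+1)%N & f`_D = c].
    by move=> c; have [[f hf]|h] := pselect (Lead D c); [exists f|exists 0].
  have {}hF c : c \in s -> [/\ I (F c), (size (F c) <= D.+1)%N & (F c)`_D = c].
    move=> cs; apply: hF; have : [set c | Lead D c] c; last by [].
    by rewrite sE; apply: ideal_gen_sub.
  exists (t ++ map F s); split=> [f|f If sf].
    by rewrite /= mem_cat => /orP [/tI //|/mapP [c /hF [Ic _ _] ->]].
  have [|g [gF Ig sg]] := cancel_coef iI hF (leqnn D) sf.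
    by rewrite -sE; exists f.
  rewrite -(subrK g f); apply: (idealD (ideal_genP _)).
    apply: (ideal_gen_min (ideal_genP _) _ (ht _ (idealB iI If Ig) sg)).
    by move=> h hh; apply: ideal_gen_sub; rewrite /= mem_cat; apply/orP; left.
  apply: (ideal_gen_min (ideal_genP _) _ gF).
  by move=> h hh; apply: ideal_gen_sub; rewrite /= mem_cat; apply/orP; right.
have iL : is_ideal [set c | exists d, Lead d c].
  split=> [|a b /= [d hd] [e he]|a b /= [d hd]].
  - by exists 0%N; apply: ideal0 (Leadz 0%N).
  - exists (maxn d e); apply: (idealD (Leadz _)).
      exact: LeadS (leq_maxl _ _) hd.
    exact: LeadS (leq_maxr _ _) he.
  - by exists d; exact: (ideal_mull a (Leadz d) hd).
have [s sE] := noethR iL.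
have [D hD] : exists D, forall c, c \in s -> Lead D c.
  have sL c : c \in s -> exists d, Lead d c.
    move=> cs; have : [set c | exists d, Lead d c] c; last by [].
    by rewrite sE; apply: ideal_gen_sub.
  elim: s sL {sE} => [|a s IH] sL; first by exists 0%N.
  have [c cs|D hD] := IH; first by apply: sL; rewrite inE cs orbT.
  have [d hd] := sL a (mem_head _ _); exists (maxn d D) => c.
  rewrite inE => /predU1P [->|/hD]; first exact: LeadS (leq_maxl _ _) hd.
  exact: LeadS (leq_maxr _ _).
have /choice [F hF] : forall c, exists f, c \in s ->
    [/\ I f, (size f <= D.+1)%N & f`_D = c].
  by move=> c; have [/hD [f hf]|h] := boolP (c \in s); [exists f|exists 0].
have [t [tI ht]] := low D.
have tsub : ideal_gen [set` t] `<=` ideal_gen [set` t ++ map F s].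
  apply: (ideal_gen_min (ideal_genP _)) => h hh.
  by apply: ideal_gen_sub; rewrite /= mem_cat; apply/orP; left.
have Fsub : ideal_gen [set` map F s] `<=` ideal_gen [set` t ++ map F s].
  apply: (ideal_gen_min (ideal_genP _)) => h hh.
  by apply: ideal_gen_sub; rewrite /= mem_cat; apply/orP; right.
exists (t ++ map F s); apply/seteqP; split; last first.
  apply: ideal_gen_min => // f; rewrite /= mem_cat.
  by case/orP=> [/tI //|/mapP [c /hF [Ic _ _] ->]].
move=> f; move: {2}(size f) (leqnn (size f)) => e; elim: e f => [|e IH] f fe If.
  move: fe; rewrite leqn0 size_poly_eq0 => /eqP ->.
  exact: ideal0 (ideal_genP _).
case: (leqP D e) => De; last by apply: tsub; apply: ht => //; apply: leq_trans De.
have [|g [gF Ig sg]] := cancel_coef iI hF De fe.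
  by rewrite -sE; exists e, f.
rewrite -(subrK g f); apply: (idealD (ideal_genP _)).
  by apply: IH => //; apply: idealB.
exact: Fsub.
Qed.

End Noetherian.

(** * Primes of finitely generated algebras in two variables *)

Section Dimension.
Variable k : fieldType.
Local Notation T := {poly {poly k}}.

Lemma linear_dependence (X Y : finType) (A : X -> Y -> k) : (#|Y| < #|X|)%N ->
  exists v : X -> k, (exists x, v x != 0) /\ forall y, \sum_x v x * A x y = 0.
Proof.
move=> YX; pose M := \matrix_(i < #|X|, j < #|Y|) A (enum_val i) (enum_val j).
have kn0 : kermx M != 0.
  rewrite -mxrank_eq0 mxrank_ker subn_eq0 -ltnNge.
  exact: leq_ltn_trans (rank_leq_col M) YX.
pose v := nz_row (kermx M).
have vM : v *m M = 0 by apply/sub_kermxP; apply: nz_row_sub.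
have : v != 0 by rewrite nz_row_eq0.
case/rV0Pn => i vi; exists (fun x => v 0 (enum_rank x)); split=> [|y].
  by exists (enum_val i); rewrite enum_valK.
move/matrixP: vM => /(_ 0 (enum_rank y)); rewrite !mxE => h; rewrite -[RHS]h.
rewrite [RHS](reindex (@enum_rank X)) /=; last first.
  by apply: onW_bij; exact: enum_rank_bij.
by apply: eq_bigr => x _; rewrite mxE !enum_rankK.
Qed.

Let bounded d (F : T) := (size F <= d.+1)%N /\ forall i, (size (F`_i)%R <= d.+1)%N.

Let bounded_ex F : exists d, bounded d F.
Proof.
exists (size F + \max_(i < size F) size (F`_i)%R)%N; split; first by rewrite ltnW // ltnS leq_addr.
move=> i; case: (ltnP i (size F)) => hi; last by rewrite nth_default ?size_poly0.
apply: leqW; apply: leq_trans (leq_addl _ _).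
exact: (leq_bigmax (Ordinal hi)).
Qed.

Let bounded_le d e F : (d <= e)%N -> bounded d F -> bounded e F.
Proof.
move=> de [h1 h2]; split=> [|i]; first exact: leq_trans h1 _.
exact: leq_trans (h2 i) _.
Qed.

Let bounded_mul d e F H : bounded d F -> bounded e H -> bounded (d + e) (F * H).
Proof.
move=> [f1 f2] [h1 h2]; split=> [|i].
  by apply: leq_trans (size_polyMleq _ _) _; lia.
rewrite coefM; apply: leq_trans (size_sum _ _ _) _; apply/bigmax_leqP => j _.
apply: leq_trans (size_polyMleq _ _) _; rewrite -subn1 leq_subLR.
by apply: leq_trans (leq_add (f2 j) (h2 _)) _; rewrite addSn addnS.
Qed.

Let bounded_exp d F a : bounded d F -> bounded (d * a) (F ^+ a).
Proof.
move=> bF; elim: a => [|a IH].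
  rewrite muln0 expr0; split=> [|i]; first by rewrite size_poly1.
  by rewrite coef1; case: (i == 0%N); rewrite ?size_poly1 ?size_poly0.
by rewrite mulnS exprS; apply: bounded_mul.
Qed.

(** A count of dimensions: the [N ^ 3] monomials in three polynomials of degree at most [d] in each
    variable lie in a space of dimension [L ^ 2], with [L = 3 * d * N + 1]. *)
Lemma algebraic_dependence (F1 F2 F3 : T) :
  exists N, exists v : nat -> nat -> nat -> k,
  (exists a b c, [/\ (a < N)%N, (b < N)%N, (c < N)%N & v a b c != 0]) /\
  \sum_(a < N) \sum_(b < N) \sum_(c < N)
    (v a b c)%:P%:P * (F3 ^+ c * F2 ^+ b * F1 ^+ a) = 0.
Proof.
have [d [b1 b2 b3]] : exists d, [/\ bounded d F1, bounded d F2 & bounded d F3].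
  have [d1 h1] := bounded_ex F1; have [d2 h2] := bounded_ex F2.
  have [d3 h3] := bounded_ex F3; exists (d1 + d2 + d3)%N.
  by split; [apply: bounded_le h1|apply: bounded_le h2|apply: bounded_le h3]; lia.
(* As [L <= (3 * d + 1) * N], it suffices for [L ^ 2 < N ^ 3] that [N] exceed [(3 * d + 1) ^ 2]. *)
pose N := ((3 * d + 1) ^ 2).+1; pose L := (3 * d * N).+1.
pose X := ('I_N * ('I_N * 'I_N))%type; pose Y := ('I_L * 'I_L)%type.
pose mon (a b c : nat) := F3 ^+ c * F2 ^+ b * F1 ^+ a.
have bmon (x : X) : bounded (3 * d * N) (mon x.1 x.2.1 x.2.2).
  case: x => a [b c] /=; have := bounded_mul (bounded_mul (bounded_exp c b3)
    (bounded_exp b b2)) (bounded_exp a b1); apply: bounded_le.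
  have ha := leq_mul (leqnn d) (ltnW (ltn_ord a)).
  have hb := leq_mul (leqnn d) (ltnW (ltn_ord b)).
  have hc := leq_mul (leqnn d) (ltnW (ltn_ord c)).
  by rewrite -mulnA; lia.
have cXY : (#|Y : finType| < #|X : finType|)%N.
  rewrite !card_prod !card_ord.
  have LN : (L <= (3 * d + 1) * N)%N by rewrite /L /N; nia.
  apply: leq_ltn_trans (leq_mul LN LN) _.
  have -> : ((3 * d + 1) * N * ((3 * d + 1) * N) = (3 * d + 1) ^ 2 * (N * N))%N.
    by rewrite -mulnn; nia.
  by rewrite ltn_mul2r /N; lia.
have [v [[[a [b c]] v0] vA]] := linear_dependence
  (fun (x : X) (y : Y) => (mon x.1 x.2.1 x.2.2)`_(y.1)`_(y.2)) cXY.
exists N, (fun a b c => v (inord a, (inord b, inord c))); split.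
  by exists a, b, c; rewrite !inord_val.
apply/polyP => i; apply/polyP => j; rewrite !coef0.
have -> : \sum_(a < N) \sum_(b < N) \sum_(c < N)
    (v (inord a, (inord b, inord c)))%:P%:P * (F3 ^+ c * F2 ^+ b * F1 ^+ a) =
    \sum_(x : X) (v x)%:P%:P * mon x.1 x.2.1 x.2.2.
  under eq_bigr => a' _ do rewrite pair_bigA.
  rewrite pair_bigA; apply: eq_bigr => [[a' [b' c']]] _.
  by rewrite !inord_val.
rewrite coef_sum; have cE (x : X) : ((v x)%:P%:P * mon x.1 x.2.1 x.2.2)`_i`_j =
    v x * (mon x.1 x.2.1 x.2.2)`_i`_j by rewrite !coefCM.
have [iL|iL] := ltnP i L; last first.
  rewrite big1 ?coef0 // => x _; rewrite coefCM (leq_sizeP _ _ _ _ iL) ?mulr0 //.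
  by case: (bmon x).
have [jL|jL] := ltnP j L; last first.
  rewrite coef_sum big1 // => x _; rewrite cE (leq_sizeP _ _ _ _ jL) ?mulr0 //.
  by case: (bmon x).
rewrite coef_sum -[RHS](vA (Ordinal iL, Ordinal jL)).
by apply: eq_bigr => x _; rewrite cE.
Qed.


(** Factors [X] can be stripped from [P], as [p] is prime and misses the image of [X]. Once the
    constant coefficient is nonzero, its image lies in [q], which contains the image of [X]. *)
Lemma lowest_coef_in_prime (E R : comNzRingType) (psi : {rmorphism {poly E} -> R})
    (p q : set R) (P : {poly E}) : is_prime p -> is_ideal q -> p `<=` q ->
  q (psi 'X) -> ~ p (psi 'X) -> P != 0 -> p (psi P) ->
  exists e, e != 0 /\ q (psi e%:P).
Proof.
move=> [ip _ pp] iq pq qX pX; elim/poly_ind: P => [|P c IH]; first by rewrite eqxx.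
have [->|c0] := eqVneq c 0.
  rewrite addr0 => P0; rewrite rmorphM /= => /pp [pP|//].
  by apply: IH pP; apply: contraNneq P0 => ->; rewrite mul0r.
move=> _; rewrite rmorphD rmorphM /= => /pq h; exists c; split => //.
apply: (ideal_transfer iq _ h).
by rewrite addrK; apply: ideal_mull.
Qed.

Lemma horner_morph_poly (E R : comNzRingType) (f : {rmorphism E -> R}) (u : R)
    (cfu : commr_rmorph f u) N (c : nat -> E) :
  horner_morph cfu (\poly_(i < N) c i) = \sum_(i < N) f (c i) * u ^+ i.
Proof.
rewrite poly_def rmorph_sum; apply: eq_bigr => i _.
by rewrite -mul_polyC rmorphM rmorphXn /= horner_morphC horner_morphX.
Qed.

(** Choose [F i] with image in [p i.+1] but not in [p i]. An algebraic relation among the three is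
    stripped of one variable at each step up the chain by [lowest_coef_in_prime], until a nonzero
    constant of [k] lands in the last prime. *)
Lemma prime_chain_le2 (R : comNzRingType) (chi : {rmorphism T -> R})
    (p : nat -> set R) : (forall i, (i <= 3)%N -> is_prime (p i)) ->
  (forall i, (i < 3)%N -> p i `<=` p i.+1 /\ p i <> p i.+1) ->
  (forall r, exists F, p 0%N (r - chi F)) -> False.
Proof.
move=> pp pS surj.
have pI i : (i <= 3)%N -> is_ideal (p i) by case/pp.
have p0S i : (i <= 3)%N -> p 0%N `<=` p i.
  elim: i => [_ r //|i IH hi r hr]; apply: (pS i hi).1; exact: IH (ltnW hi) _ hr.
have /choice [F hF] : forall i, exists f : T, (i < 3)%N ->
    p i.+1 (chi f) /\ ~ p i (chi f).
  move=> i; have [i3|] := boolP (i < 3)%N; last by exists 0.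
  have [sub ne] := pS i i3.
  have [r [r1 r0]] : exists r, p i.+1 r /\ ~ p i r.
    apply: contrapT => h; apply: ne; apply/seteqP; split => // r r1.
    by apply: contrapT => r0; apply: h; exists r.
  have [G hG] := surj r; exists G => _; split.
    by apply: (ideal_transfer (pI _ i3) _ r1); apply: p0S.
  move=> h; apply: r0; apply: (ideal_transfer (pI _ (ltnW i3)) _ h).
  by rewrite -opprB; apply: idealN; [apply: pI; apply: ltnW|apply: p0S => //; apply: ltnW].
have [N [v [[a [b [c [aN bN cN vabc]]]] rel]]] :=
  algebraic_dependence (F 0%N) (F 1%N) (F 2%N).
pose psi0 : {rmorphism k -> R} := GRing.RMorphism.clone _ _ (chi \o (polyC \o polyC)) _.
have c1 : commr_rmorph psi0 (chi (F 2%N)) by move=> x; apply: mulrC.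
pose psi1 : {rmorphism _ -> R} := GRing.RMorphism.clone _ _ (horner_morph c1) _.
have c2 : commr_rmorph psi1 (chi (F 1%N)) by move=> x; apply: mulrC.
pose psi2 : {rmorphism _ -> R} := GRing.RMorphism.clone _ _ (horner_morph c2) _.
have c3 : commr_rmorph psi2 (chi (F 0%N)) by move=> x; apply: mulrC.
pose psi3 : {rmorphism _ -> R} := GRing.RMorphism.clone _ _ (horner_morph c3) _.
pose P := \poly_(a < N) \poly_(b < N) \poly_(c < N) v a b c.
have P0 : P != 0.
  apply: contraNneq vabc => /polyP /(_ a); rewrite coef_poly aN coef0.
  by move=> /polyP /(_ b); rewrite coef_poly bN coef0 => /polyP /(_ c);
    rewrite coef_poly cN coef0 => ->.
have PE : psi3 P = 0.
  rewrite -[RHS](rmorph0 chi) -rel rmorph_sum /= horner_morph_poly.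
  apply: eq_bigr => i _; rewrite [psi2 _]horner_morph_poly rmorph_sum mulr_suml.
  apply: eq_bigr => j _; rewrite [psi1 _]horner_morph_poly rmorph_sum !mulr_suml.
  by apply: eq_bigr => l _; rewrite !rmorphM !rmorphXn /= !mulrA.
have [h1 h1'] := hF 0%N isT; have [h2 h2'] := hF 1%N isT; have [h3 h3'] := hF 2%N isT.
have [||||e1 [e1n p1]] := @lowest_coef_in_prime _ _ psi3 _ _ P (pp 0%N isT) (pI 1%N isT) (pS 0%N isT).1.
- by rewrite /= horner_morphX.
- by rewrite /= horner_morphX.
- exact: P0.
- by rewrite PE; apply: ideal0; apply: pI.
rewrite /= horner_morphC in p1.
have [||||e2 [e2n p2]] := @lowest_coef_in_prime _ _ psi2 _ _ e1 (pp 1%N isT) (pI 2%N isT) (pS 1%N isT).1.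
- by rewrite /= horner_morphX.
- by rewrite /= horner_morphX.
- exact: e1n.
- exact: p1.
rewrite /= horner_morphC in p2.
have [||||e3 [e3n p3]] := @lowest_coef_in_prime _ _ psi1 _ _ e2 (pp 2%N isT) (pI 3%N isT) (pS 2%N isT).1.
- by rewrite /= horner_morphX.
- by rewrite /= horner_morphX.
- exact: e2n.
- exact: p2.
rewrite /= horner_morphC in p3.
have [_ + _] := pp 3%N isT; apply.
have := ideal_mull (psi0 e3^-1) (pI 3%N isT) p3.
by rewrite -[psi0 e3^-1 * _]rmorphM mulVf // rmorph1.
Qed.

(* If a maximal ideal met [k[s]] in zero, the inverse of [1 + s c(s)], with
   [c] the leading coefficient of an element of minimal degree in [t], would
   have a denominator dividing a power of [c]. *)
Lemma field_quotient_meets (N : set T) : is_ideal N -> ~ N 1 ->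
  (forall f, ~ N f -> exists f', N (f * f' - 1)) ->
  exists p : {poly k}, p != 0 /\ N p%:P.
Proof.
move=> iN N1 inv; apply: contrapT => nop.
have C0 c : N c%:P -> c = 0.
  by move=> Nc; apply: contrapT => /eqP c0; apply: nop; exists c.
have [g0 [Ng0 g0n]] : exists g, N g /\ g != 0.
  have [NX|/inv [f' h]] := pselect (N 'X); first by exists 'X; rewrite polyX_eq0.
  exists ('X * f' - 1); split => //; apply/eqP => /polyP /(_ 0%N).
  by rewrite coefB mulrC coefMX coef1 coef0 sub0r => /eqP; rewrite oppr_eq0 oner_eq0.
have [g [Ng gn gmin]] : exists g, [/\ N g, g != 0 &
    forall h, N h -> (size h < size g)%N -> h = 0].
  move: {2}(size g0) (leqnn (size g0)) Ng0 g0n => d.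
  elim: d g0 => [|d IH] g sg Ng gn.
    by move: sg; rewrite leqn0 size_poly_eq0 (negPf gn).
  have [[h [Nh hg hn]]|nh] :=
    pselect (exists h, [/\ N h, (size h < size g)%N & h != 0]).
    by apply: (IH h) => //; rewrite -ltnS (leq_trans hg).
  by exists g; split=> // h Nh hg; apply: contrapT => /eqP hn; apply: nh; exists h.
pose c := lead_coef g; have c0 : c != 0 by rewrite lead_coef_eq0.
have sg : (1 < size g)%N.
  rewrite ltnNge; apply/negP => /size1_polyC gE.
  by move: gn; rewrite gE (C0 g`_0) ?eqxx // -gE.
pose h : {poly k} := 1 + 'X * c.
have h0 : h != 0.
  apply/eqP => /polyP /(_ 0%N); rewrite coefD mulrC coefMX coef1 coef0 addr0.
  by move/eqP; rewrite oner_eq0.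
have [f' hf'] : exists f', N (h%:P * f' - 1).
  by apply: inv => /C0/eqP; apply/negP.
pose e := scalp f' g; pose q := f' %/ g; pose rho := f' %% g.
have srho : (size rho < size g)%N by rewrite ltn_modp.
(* Pseudo-division of the inverse [f'] of [h] by [g]. Then [h rho - c ^ e] lies in [N] with degree
   in [t] below that of [g], so it vanishes and [h] divides [c ^ e]. *)
have divE : (c ^+ e) *: f' = q * g + rho by apply: Pdiv.Idomain.divp_eq.
have : N (h%:P * rho - (c ^+ e)%:P).
  have -> : h%:P * rho - (c ^+ e)%:P =
      (c ^+ e)%:P * (h%:P * f' - 1) - h%:P * q * g.
    have -> : rho = (c ^+ e)%:P * f' - q * g by rewrite mul_polyC divE addrC addKr.
    have alg (H C F Q G : T) : H * (C * F - Q * G) - C =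
        C * (H * F - 1) - H * Q * G by ring.
    exact: alg.
  by apply: idealB => //; apply: ideal_mull.
move/gmin => hrho.
have {hrho} : h%:P * rho - (c ^+ e)%:P = 0.
  apply: hrho; apply: leq_ltn_trans (size_polyD _ _) _.
  rewrite size_polyN gtn_max (leq_ltn_trans (size_polyC_leq1 _) sg) andbT.
  by rewrite mul_polyC (leq_ltn_trans (size_scale_leq _ _)).
move/polyP/(_ 0%N)/eqP; rewrite coef0 coefB coefC /= mul_polyC coefZ subr_eq0.
move/eqP => hce.
(* But [h = 1 + s c] is coprime to [c], so [h] would be a constant, against its positive degree in
   [s]. *)
have hc : coprimep h (c ^+ e).
  apply: coprimep_expr; rewrite /h coprimep_sym.
  apply/Bezout_eq1_coprimepP; by exists (- 'X, 1); rewrite /= mulNr mul1r addrC addrK.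
have : h %| c ^+ e by rewrite -hce dvdp_mulr.
move=> hd; have : size h == 1%N.
  by rewrite -dvdp1 -(Gauss_dvdpl _ hc) mul1r.
rewrite /h addrC size_polyDl; first by rewrite mulrC size_mulX // eqSS size_poly_eq0 (negPf c0).
by rewrite mulrC size_mulX // size_poly1 ltnS lt0n size_poly_eq0.
Qed.
End Dimension.

(** * Regularity modulo powers of a regular sequence *)

Section QuasiRegular.
Variables (S : comNzRingType) (f g : S) (K : set S).
Hypothesis iK : is_ideal K.

Definition ideal2 : set S := ideal_add (principal f) (principal g).

Let iA : is_ideal ideal2.
Proof. by apply: ideal_addP; apply: principalP. Qed.

Let Af : ideal2 f.
Proof. exact: ideal_addl (principalP _) _ (principal_id f). Qed.

Let Ag : ideal2 g.
Proof. exact: ideal_addr (principalP _) _ (principal_id g). Qed.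

(** The homogeneous form of degree [m] in [f] and [g] with coefficients [c]. *)
Let form m (c : nat -> S) := \sum_(i < m.+1) c i * (f ^+ i * g ^+ (m - i)).

Let pow_form m y : ideal_pow ideal2 m y -> exists c, y = form m c.
Proof.
elim: m y => [|m IH] y.
  by exists (fun=> y); rewrite /form big_ord1 expr0 mulr1 mulr1.
move: y; apply: (ideal_gen_min (I := [set y | exists c, y = form m.+1 c])).
  split=> [|_ _ [c ->] [d ->]|a _ [c ->]].
  - by exists (fun=> 0); rewrite /form big1 // => i _; rewrite mul0r.
  - exists (fun i => c i + d i); rewrite -big_split.
    by apply: eq_bigr => i _; rewrite mulrDl.
  - exists (fun i => a * c i); rewrite /form mulr_sumr.
    by apply: eq_bigr => i _; rewrite mulrA.
move=> _ [_ [z [[_ [_ [[p ->] [q ->] ->]]] /IH [c ->] ->]]].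
exists (fun i => (if i is j.+1 then p * c j else 0) +
                 (if (i <= m)%N then q * c i else 0)).
under [RHS]eq_bigr do rewrite mulrDl.
rewrite big_split /= mulrDl; congr (_ + _).
  rewrite /form mulr_sumr [RHS]big_ord_recl mul0r add0r; apply: eq_bigr => i _.
  by rewrite /= /bump leq0n add1n subSS exprS; ring.
rewrite /form mulr_sumr [RHS]big_ord_recr /= ltnn mul0r addr0.
apply: eq_bigr => i _; have im : (i <= m)%N by rewrite -ltnS.
by rewrite im subSn // exprS; ring.
Qed.

Let pow_form_coef m y : ideal_pow ideal2 m.+1 y ->
  exists d, (forall i, ideal2 (d i)) /\ y = form m d.
Proof.
move: y; apply: (ideal_gen_min (I := [set y | exists d,
  (forall i, ideal2 (d i)) /\ y = form m d])).
  split=> [|_ _ [c [hc ->]] [d [hd ->]]|a _ [c [hc ->]]].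
  - exists (fun=> 0); split=> [_|]; first exact: ideal0.
    by rewrite /form big1 // => i _; rewrite mul0r.
  - exists (fun i => c i + d i); split=> [i|]; first exact: idealD.
    by rewrite -big_split; apply: eq_bigr => i _; rewrite mulrDl.
  - exists (fun i => a * c i); split=> [i|]; first exact: ideal_mull.
    by rewrite /form mulr_sumr; apply: eq_bigr => i _; rewrite mulrA.
move=> _ [a [z [Aa /pow_form [c ->] ->]]].
exists (fun i => a * c i); split=> [i|]; first exact: ideal_mulr.
by rewrite /form mulr_sumr; apply: eq_bigr => i _; rewrite mulrA.
Qed.

Hypothesis rf : regular_mod K f.
Hypothesis rg : regular_mod (ideal_add K (principal f)) g.

(** A regular sequence is quasi-regular. Modulo [K] and [f] only the pure power of [g] remains, so
    its coefficient lies in [K + (f)]; substituting this and cancelling [f] leaves a form of degree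
    one less. *)
Let quasi_regular m c : K (form m c) ->
  forall i, (i <= m)%N -> ideal_add K ideal2 (c i).
Proof.
have iKA : is_ideal (ideal_add K ideal2) by apply: ideal_addP.
have KA : K `<=` ideal_add K ideal2 by apply: ideal_addl.
have AA : ideal2 `<=` ideal_add K ideal2 by apply: ideal_addr.
have iKf : is_ideal (ideal_add K (principal f)).
  by apply: ideal_addP => //; apply: principalP.
elim: m c => [|m IH] c.
  rewrite /form big_ord1 !expr0 !mulr1 => Kc i; rewrite leqn0 => /eqP ->.
  exact: KA.
pose z := \sum_(i < m.+1) c i.+1 * (f ^+ i * g ^+ (m - i)).
have -> : form m.+1 c = g ^+ m.+1 * c 0%N + f * z.
  rewrite /form big_ord_recl expr0 mul1r subn0 mulrC; congr (_ + _).
  rewrite mulr_sumr; apply: eq_bigr => i _.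
  by rewrite /= /bump leq0n add1n subSS exprS; ring.
move=> Kh.
have : ideal_add K (principal f) (g ^+ m.+1 * c 0%N).
  apply: (ideal_transfer iKf (x := g ^+ m.+1 * c 0%N + f * z)).
    rewrite addrAC subrr add0r.
    by apply: ideal_addr => //; exists z; rewrite mulrC.
  by apply: ideal_addl => //; apply: principalP.
move/(regular_modX rg) => [kap [_ [Kkap [e ->] c0]]].
have Kin : K (e * g ^+ m.+1 + z).
  apply: rf; have -> : f * (e * g ^+ m.+1 + z) =
      (g ^+ m.+1 * c 0%N + f * z) - g ^+ m.+1 * kap by rewrite c0; ring.
  by apply: idealB => //; apply: ideal_mull.
(* The leftover [e g ^ (m + 1)] is absorbed into the coefficient of [g ^ m]. *)
pose c' i := if i is 0%N then c 1%N + e * g else c i.+1.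
have E : e * g ^+ m.+1 + z = form m c'.
  rewrite /z /form 2!big_ord_recl /= expr0 subn0 mul1r addrA mulrDl.
  by rewrite exprS; ring.
move: Kin; rewrite E => /IH hc' [_|[|i] im].
- by rewrite c0; apply: idealD => //; [apply: KA|apply: AA; apply: ideal_mull].
- have := hc' 0%N isT => /= h; apply: (ideal_transfer iKA _ h).
  by rewrite addrAC subrr add0r; apply: AA; apply: ideal_mull.
- exact: (hc' i.+1).
Qed.

(** The induction climbs the filtration by powers: by quasi-regularity each successive quotient is
    free over the quotient by [K + (f, g)], so regularity of [v] is tested on the coefficients of
    forms. *)
Lemma regular_mod_pow v m : regular_mod (ideal_add K ideal2) v ->
  regular_mod (ideal_add K (ideal_pow ideal2 m)) v.
Proof.
move=> rv; have iKA : is_ideal (ideal_add K ideal2) by apply: ideal_addP.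
elim: m => [|m IH] w; first by move=> _; apply: ideal_addr.
have iAm := ideal_powP ideal2 m; have iAm1 := ideal_powP ideal2 m.+1.
have iKm : is_ideal (ideal_add K (ideal_pow ideal2 m.+1)) by apply: ideal_addP.
move=> [ka [y [Kka Ay vw]]].
have [kb [_ [Kkb /pow_form [c ->] wE]]] : ideal_add K (ideal_pow ideal2 m) w.
  by apply: IH; exists ka, y; split => //; apply: ideal_powSW.
have [d [Ad yE]] := pow_form_coef Ay.
have hK : K (form m (fun i => v * c i - d i)).
  have -> : form m (fun i => v * c i - d i) = ka - v * kb.
    have -> : form m (fun i => v * c i - d i) = v * form m c - form m d.
      rewrite /form mulr_sumr -sumrB; apply: eq_bigr => i _.
      by rewrite mulrBl mulrA.
    by rewrite -yE; move: vw; rewrite wE mulrDr => /(canRL (addKr _)) ->; ring.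
  by apply: idealB => //; apply: ideal_mull.
have hc i : (i <= m)%N -> ideal_add K ideal2 (c i).
  move=> im; apply: rv; apply: (ideal_transfer iKA (x := v * c i - d i)).
    by rewrite addrAC subrr add0r; apply: idealN => //; apply: ideal_addr.
  exact: quasi_regular hK i im.
rewrite wE; apply: idealD => //; first exact: ideal_addl.
apply: ideal_sum => // i _.
have [kap [a [Kkap Aa ->]]] := hc i (ltn_ord i : (i <= m)%N).
rewrite mulrDl; apply: idealD => //.
  by apply: ideal_addl => //; apply: ideal_mulr.
apply: ideal_addr => //; apply: ideal_powS => //.
have /subnKC {1}<- : (i <= m)%N by rewrite -ltnS.
by apply: ideal_powD; apply: ideal_powX.
Qed.

End QuasiRegular.

(** * Regular elements in polynomial extensions *)

Section PolynomialExtension.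
Variable E : comNzRingType.
Implicit Types (K : set E) (f g h w : {poly E}).

Definition poly_ideal K : set {poly E} := [set h | forall i, K h`_i].

Lemma poly_idealP K : is_ideal K -> is_ideal (poly_ideal K).
Proof.
move=> iK; split=> [i|f g Kf Kg i|f g Kg i].
- by rewrite coef0; apply: ideal0.
- by rewrite coefD; apply: idealD.
- by rewrite coefM; apply: ideal_sum => // j _; apply: ideal_mull.
Qed.

(** Descending induction on [i]: as [f] is monic, the coefficient of [f * w] in degree
    [i + (size f).-1] is that of [w] in degree [i] plus multiples of higher coefficients of [w]. *)
Lemma monic_high_coefs K f w : is_ideal K -> f \is monic ->
  (forall i, K (f * w)`_(i + (size f).-1)) -> poly_ideal K w.
Proof.
move=> iK mf fw.
suff H d i : (size w <= i + d)%N -> K w`_i by move=> i; apply: (H (size w)); apply: leq_addl.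
elim: d i => [|d IH] i hi.
  by rewrite nth_default ?(leq_trans hi) ?addn0 //; apply: ideal0.
have := fw i; rewrite coefM.
have hs : ((size f).-1 < (i + (size f).-1).+1)%N by rewrite ltnS leq_addl.
rewrite (bigD1 (Ordinal hs)) //= addnK -lead_coefE (eqP mf) mul1r => h.
apply: (ideal_transfer iK _ h); rewrite addrAC subrr add0r.
apply: ideal_sum => // j; rewrite -val_eqE /= => jn.
have [js|js] := leqP (size f).-1 j.
  rewrite nth_default ?mul0r; first exact: ideal0.
  by apply: leq_trans (leqSpred _) _; rewrite ltn_neqAle eq_sym jn.
apply: ideal_mull => //; apply: IH; apply: leq_trans hi _.
by rewrite addnS -addSn leq_add2r ltn_subRL addnC ltn_add2l.
Qed.

Lemma monic_regular K f : is_ideal K -> f \is monic -> regular_mod (poly_ideal K) f.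
Proof. by move=> iK mf w fw; apply: (monic_high_coefs iK mf) => i; apply: fw. Qed.

Lemma polyC_regular K u : regular_mod K u -> regular_mod (poly_ideal K) u%:P.
Proof. by move=> ru w uw i; apply: ru; have := uw i; rewrite coefCM. Qed.

(** Division by the monic [f] represents [w] by a remainder [r]. Modulo [K], the product [u r] is a
    multiple of [f] of smaller degree than [f], so it vanishes there, and regularity of [u] applies
    coefficientwise. *)
Lemma polyC_regular_monic K f u : is_ideal K -> f \is monic -> regular_mod K u ->
  regular_mod (ideal_add (poly_ideal K) (principal f)) u%:P.
Proof.
move=> iK mf ru w [ka [_ [Kka [c ->] uw]]].
have iP := poly_idealP iK.
set q := Pdiv.Ring.rdivp w f; set r := Pdiv.Ring.rmodp w f.
have wE : w = q * f + r by apply: Pdiv.RingMonic.rdivp_eq.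
have sr : (size r < size f)%N by rewrite Pdiv.Ring.ltn_rmodpN0 ?monic_neq0.
pose e := c - u%:P * q.
have efE : f * e = u%:P * r - ka.
  apply/eqP; rewrite -subr_eq0; apply/eqP; rewrite /e.
  move: uw; rewrite wE mulrDr => uw.
  have -> : ka = u%:P * (q * f) + u%:P * r - c * f by rewrite uw addrK.
  by ring.
have Ke : poly_ideal K e.
  apply: (monic_high_coefs iK mf) => i; rewrite efE coefB coefCM.
  rewrite [r`__]nth_default ?mulr0 ?sub0r; first by apply: idealN.
  by apply: leq_trans (leq_addl _ _); rewrite -ltnS (leq_trans sr (leqSpred _)).
have Kr : poly_ideal K r.
  apply: (polyC_regular ru).
  have -> : u%:P * r = f * e + ka by rewrite efE subrK.
  by apply: (idealD iP) => //; apply: (ideal_mull _ iP).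
exists r, (q * f); split => //; first by exists q.
by rewrite addrC -wE.
Qed.

Lemma poly_ideal_add_principal K a : is_ideal K ->
  poly_ideal (ideal_add K (principal a)) =
  ideal_add (poly_ideal K) (principal a%:P).
Proof.
move=> iK; apply/seteqP; split=> [h Kh|_ [f [_ [Kf [c ->] ->]]] i]; last first.
  by rewrite coefD coefMC; exists f`_i, (c`_i * a); split=> //; exists c`_i.
have /choice [c hc] : forall i, exists c, K (h`_i - c * a).
  by move=> i; have [x [_ [Kx [c ->] ->]]] := Kh i; exists c; rewrite addrK.
pose C := \poly_(i < size h) c i.
exists (h - C * a%:P), (C * a%:P); split; [|by exists C|by rewrite subrK].
move=> i; rewrite coefB coefMC coef_poly; case: ltnP => hi; first exact: hc.
by rewrite nth_default // mul0r subrr; apply: ideal0.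
Qed.

Lemma poly_ideal0 : poly_ideal [set 0] = [set 0].
Proof.
by apply/seteqP; split=> [h h0|h -> i]; [apply/polyP => i; rewrite coef0; apply: h0|rewrite coef0].
Qed.

End PolynomialExtension.

Section IteratedRegular.
Variables (D : comNzRingType) (K : set D).
Hypothesis iK : is_ideal K.
Variables (f : {poly D}) (g : {poly {poly D}}).
Hypotheses (mf : f \is monic) (mg : g \is monic).
Let K2 := poly_ideal (poly_ideal K).

Lemma ideal_addA (R : comNzRingType) (I J L : set R) :
  ideal_add I (ideal_add J L) = ideal_add (ideal_add I J) L.
Proof.
apply/seteqP; split=> [_ [a [_ [Ia [b [c [Jb Lc ->]]] ->]]]|
  _ [_ [c [[a [b [Ia Jb ->]]] Lc ->]]]].
  by exists (a + b), c; rewrite addrA; split => //; exists a, b.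
by exists a, (b + c); rewrite addrA; split => //; exists b, c.
Qed.

(** Being monic in successive variables, [f] and [g] form a regular sequence modulo [K], and [v]
    stays regular after dividing by each. The choices [K = 0] and [K = (u)] give the two steps of a
    regular sequence [u], [v]. *)
Lemma iterated_regular_pow v m : regular_mod K v ->
  regular_mod (ideal_add K2 (ideal_pow (ideal2 f%:P g) m)) v%:P%:P.
Proof.
move=> rv; have iK1 := poly_idealP iK; have iK2 := poly_idealP iK1.
have iKf : is_ideal (ideal_add (poly_ideal K) (principal f)).
  by apply: ideal_addP => //; apply: principalP.
apply: regular_mod_pow => //.
- by apply: polyC_regular; apply: monic_regular.
- by rewrite -poly_ideal_add_principal //; apply: monic_regular.
- rewrite /ideal2 ideal_addA -poly_ideal_add_principal //.
  by apply: polyC_regular_monic => //; apply: polyC_regular_monic.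
Qed.

End IteratedRegular.

(** * Powers of a complete intersection *)

Lemma ideal_add0 (E : comNzRingType) (I : set E) : ideal_add [set 0] I = I.
Proof.
apply/seteqP; split=> [_ [_ [y [-> hy ->]]]|y hy]; first by rewrite add0r.
by exists 0, y; rewrite add0r.
Qed.

Lemma poly_ideal_principal (E : comNzRingType) (z : E) :
  poly_ideal (principal z) = principal z%:P.
Proof.
have := poly_ideal_add_principal z (ideal_zero E).
by rewrite ideal_add0 poly_ideal0 ideal_add0.
Qed.

Section CompleteIntersection.
Variables (D : comNzRingType) (sig tau : D).

(** With [X] as [x_a] and [sig] as [x_a - x_c], this is [x_a x_c]; likewise [ci_g] is [x_b x_d]. *)
Definition ci_f : {poly D} := 'X * ('X - sig%:P).
Definition ci_g : {poly {poly D}} := 'X * ('X - tau%:P%:P).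
Definition ci_ideal := ideal2 ci_f%:P ci_g.

Variables (R : comNzRingType) (rho : {rmorphism {poly {poly D}} -> R}) (m : nat).
Hypothesis rho_surj : forall r, exists h, rho h = r.
Hypothesis rho_ker : forall h, rho h = 0 <-> ideal_pow ci_ideal m h.

Lemma horner_congruent (E : comNzRingType) (phi : {rmorphism {poly E} -> R})
    (Q : set R) (u : E) : is_ideal Q -> Q (phi ('X - u%:P)) ->
  forall h : {poly E}, Q (phi h - phi (h.[u])%:P).
Proof.
move=> iQ Qu h; have /factor_theorem [q hq] : root (h - (h.[u])%:P) u.
  by rewrite /root hornerD hornerN hornerC subrr.
by rewrite -rmorphB hq rmorphM; apply: ideal_mull.
Qed.

(** A prime contains a factor of each generator, so modulo [Q] the variable [x_a] becomes zero or
    [sig], and [x_b] becomes zero or [tau]. Every element is then congruent to one coming from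
    [D]. *)
Lemma chi_surj_mod (Q : set R) : is_prime Q -> forall r, exists F, Q (r - rho F%:P%:P).
Proof.
move=> pQ r; have iQ : is_ideal Q by case: pQ.
have Qpow z n : Q (z ^+ n) -> Q z.
  case: pQ => _ Q1 pQ; elim: n => [|n IH]; first by rewrite expr0.
  by rewrite exprS => /pQ [].
have Q0 z : ci_ideal z -> Q (rho z).
  move=> Az; apply: (Qpow _ m); rewrite -rmorphXn.
  by have /rho_ker -> := ideal_powX m Az; apply: ideal0.
have [x Qx] : exists x : D, Q (rho ('X - x%:P)%:P).
  have : Q (rho ci_f%:P) by apply: Q0; apply: ideal_addl (principalP _) _ (principal_id _).
  rewrite /ci_f polyCM rmorphM; case: (pQ) => _ _ h /h []; last by exists sig.
  by exists 0; rewrite subr0.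
have [y Qy] : exists y : {poly D}, Q (rho ('X - y%:P)).
  have : Q (rho ci_g) by apply: Q0; apply: ideal_addr (principalP _) _ (principal_id _).
  rewrite /ci_g rmorphM; case: (pQ) => _ _ h /h []; last by exists tau%:P.
  by exists 0; rewrite subr0.
have [h hr] := rho_surj r; exists (h.[y]).[x].
pose rho3 : {rmorphism {poly D} -> R} := GRing.RMorphism.clone _ _ (rho \o polyC) _.
have h1 := horner_congruent iQ Qy h.
have h2 := horner_congruent (phi := rho3) iQ Qx h.[y].
rewrite /= in h2; have := idealD iQ h1 h2.
by rewrite addrA subrK hr.
Qed.


Lemma ci_regular_seq (M : set R) (u v : D) : is_prime M ->
  regular_mod [set 0] u -> regular_mod (principal u) v ->
  M (rho u%:P%:P) -> M (rho v%:P%:P) -> regular_seq_in M 2.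
Proof.
move=> [iM M1 _] ru rv Mu Mv.
have iA := ideal_powP ci_ideal m.
have mf : ci_f \is monic by rewrite /ci_f monicMl ?monicX ?monicXsubC.
have mg : ci_g \is monic by rewrite /ci_g monicMl ?monicX ?monicXsubC.
have ruA : regular_mod (ideal_pow ci_ideal m) u%:P%:P.
  have := @iterated_regular_pow D _ (ideal_zero D) _ _ mf mg u m ru.
  by rewrite !poly_ideal0 ideal_add0.
have rvA : regular_mod (ideal_add (principal u%:P%:P) (ideal_pow ci_ideal m)) v%:P%:P.
  by have := @iterated_regular_pow D _ (principalP u) _ _ mf mg v m rv; rewrite !poly_ideal_principal.
exists [:: rho u%:P%:P; rho v%:P%:P]; split => //; last first.
  by move=> z /=; rewrite !inE => /orP[]/eqP ->.
split=> [i i2 r|/ideal_gen_seqP [c]]; last first.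
  rewrite big_ord_recl big_ord1 /= => e; apply: M1; rewrite e.
  by apply: idealD => //; apply: ideal_mull.
have [h <-] := rho_surj r; case: i i2 => [|[|//]] _ /ideal_gen_seqP [c] /=.
  rewrite big_ord0 -rmorphM => /rho_ker /ruA /rho_ker ->.
  exact: ideal0 (ideal_genP _).
rewrite big_ord1 /= => e; have [c' c'E] := rho_surj (c 0%N).
have [|_ [y [[d ->] Ay hE]]] := rvA h.
  exists (c' * u%:P%:P), (v%:P%:P * h - c' * u%:P%:P).
  split; [by exists c'| |by rewrite addrC subrK].
  by apply/rho_ker; rewrite rmorphB !rmorphM c'E e subrr.
rewrite hE rmorphD (_ : rho y = 0) ?addr0 ?rmorphM; last exact/rho_ker.
apply: (ideal_mull _ (ideal_genP _)); apply: ideal_gen_sub => /=.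
by rewrite inE.
Qed.
End CompleteIntersection.

Section CompleteIntersectionField.
Variable k : fieldType.
Local Notation D := {poly {poly k}}.

Variables (R : comNzRingType) (rho : {rmorphism {poly {poly D}} -> R}) (m : nat).
Hypothesis rho_surj : forall r, exists h, rho h = r.
Hypothesis rho_ker : forall h,
  rho h = 0 <-> ideal_pow (ci_ideal ('X%:P : D) ('X : D)) m h.

Variables (chi : {rmorphism D -> R}).
Hypothesis chiE : forall F, chi F = rho F%:P%:P.

Lemma ci_prime_chain (M : set R) l : prime_chain_below M l -> (l <= 2)%N.
Proof.
move=> [p [pp pS _]]; rewrite leqNgt; apply/negP => l3.
apply: (@prime_chain_le2 k R chi p) => [i i3|i i3|r].
- by apply: pp; apply: leq_trans l3.
- by apply: pS; apply: leq_trans l3.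
- have [F hF] := chi_surj_mod rho_surj rho_ker (pp 0%N isT) r.
  by exists F; rewrite chiE.
Qed.

(** An element outside [M] is invertible modulo [M], and its inverse is congruent to an element of
    [D], so [field_quotient_meets] applies to the preimage of [M]. The map [phi] is free so that the
    two variables can be exchanged. *)
Lemma chi_field_quotient (M : set R) (phi : {rmorphism D -> R}) :
  is_maximal M -> (forall F, exists F', phi F' = chi F) ->
  exists p : {poly k}, p != 0 /\ M (phi p%:P).
Proof.
move=> maxM phi_chi; have [iM M1 topM] := maxM.
have pM := maximal_prime maxM.
apply: (field_quotient_meets (N := phi @^-1` M)).
- exact: preimage_idealP.
- by rewrite /preimage /= rmorph1.
move=> F nF; rewrite /preimage /=.
have [r Mr] : exists r, M (phi F * r - 1).
  apply: contrapT => nr; apply: nF.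
  pose N := ideal_add M (principal (phi F)).
  have iN : is_ideal N by apply: ideal_addP => //; apply: principalP.
  have NF : N (phi F) by apply: ideal_addr (principal_id _).
  have <- : N = M; last by [].
  apply: topM => //; first by apply: ideal_addl; apply: principalP.
  move=> [a [_ [Ma [c ->] e]]]; apply: nr; exists c.
  have -> : phi F * c - 1 = - a by rewrite e; ring.
  exact: idealN.
have [G hG] := chi_surj_mod rho_surj rho_ker pM r.
have [G' hG'] := phi_chi G; exists G'.
rewrite rmorphB rmorphM rmorph1 hG' chiE.
apply: (ideal_transfer iM _ Mr).
move: (rho _) hG => z hG.
have -> : phi F * r - 1 - (phi F * z - 1) = phi F * (r - z) by ring.
exact: ideal_mull.
Qed.

(** The sequence is a nonzero [p(s)] followed by [q(t)], the latter found by applying the same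
    argument after swapping [s] and [t]. *)
Lemma ci_maximal_regular_seq (M : set R) : is_maximal M -> regular_seq_in M 2.
Proof.
move=> maxM; have [iM M1 _] := maxM; have pM := maximal_prime maxM.
have [p [p0 Mp]] := chi_field_quotient (phi := chi) maxM (fun F => ex_intro _ F erefl).
pose chi' : {rmorphism D -> R} := GRing.RMorphism.clone _ _ (chi \o swapXY) _.
have [|q [q0 Mq]] := chi_field_quotient (phi := chi') maxM.
  by move=> F; exists (swapXY F); rewrite /= swapXYK.
(* Made monic in [t], the second element is regular modulo the extension of the ideal of [p(s)]. *)
pose q1 := (lead_coef q)^-1 *: q.
pose Q : D := q1^:P.
have mQ : Q \is monic.
  rewrite map_monic monicE lead_coefZ mulVf // lead_coef_eq0.
  exact: q0.
have MQ : M (chi Q).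
  have -> : chi Q = chi' ((lead_coef q)^-1)%:P%:P * chi' q%:P.
    by rewrite -rmorphM -polyCM mul_polyC /= swapXY_polyC.
  exact: ideal_mull.
have rp : regular_mod [set 0] (p%:P : D).
  by move=> w /eqP; rewrite mulf_eq0 polyC_eq0 (negPf p0) => /eqP.
have rQ : regular_mod (principal (p%:P : D)) Q.
  by rewrite -poly_ideal_principal; apply: monic_regular => //; apply: principalP.
apply: (ci_regular_seq rho_surj rho_ker pM rp rQ); rewrite -chiE //.
Qed.

Hypothesis noethR : noetherian R.

(** Height and depth are both two: a regular sequence of length two yields a chain of length two,
    and the bound on chains also bounds regular sequences. *)
Lemma ci_cohen_macaulay : cohen_macaulay R.
Proof.
split=> // M maxM; have pM := maximal_prime maxM.
have rM := ci_maximal_regular_seq maxM.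
have chain l : regular_seq_in M l -> prime_chain_below M l.
  by move=> [s [rs sM <-]]; apply: regular_seq_chain.
exists 2%N; split; split => //.
- exact: chain.
- by move=> l; apply: ci_prime_chain.
- by move=> l /chain; apply: ci_prime_chain.
Qed.

End CompleteIntersectionField.

(** * Four-cycles *)

Section Lifting.

Lemma poly_lift (E B : comNzRingType) (f : {rmorphism E -> B}) (u : B) :
  exists g : {rmorphism {poly E} -> B}, (forall e, g e%:P = f e) /\ g 'X = u.
Proof.
have cfu : commr_rmorph f u by move=> e; apply: mulrC.
exists (GRing.RMorphism.clone _ _ (horner_morph cfu) _); split=> [e|] /=.
  exact: horner_morphC.
exact: horner_morphX.
Qed.

Lemma poly_rmorph_ext (E B : comNzRingType) (f g : {rmorphism {poly E} -> B}) :
  (forall e, f e%:P = g e%:P) -> f 'X = g 'X -> forall h, f h = g h.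
Proof.
move=> fgC fgX; elim/poly_ind => [|h e IH]; first by rewrite !rmorph0.
by rewrite !rmorphD !rmorphM IH fgC fgX.
Qed.

Lemma poly_restrict (E B : comNzRingType) (f : {rmorphism {poly E} -> B}) :
  exists f0 : {rmorphism E -> B}, forall e, f0 e = f e%:P.
Proof. by exists (GRing.RMorphism.clone _ _ (f \o polyC) _). Qed.

Lemma poly2_rmorph_ext (E B : comNzRingType)
    (f g : {rmorphism {poly {poly E}} -> B}) :
  (forall e, f e%:P%:P = g e%:P%:P) -> f 'X%:P = g 'X%:P -> f 'X = g 'X ->
  forall h, f h = g h.
Proof.
have [f1 F1] := poly_restrict f; have [g1 G1] := poly_restrict g.
move=> h0 h1 h2; apply: poly_rmorph_ext h2 => e; rewrite -F1 -G1.
by move: e; apply: poly_rmorph_ext => [e|]; rewrite F1 G1.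
Qed.

Lemma mpoly_lift (k B : comNzRingType) n (f : {rmorphism k -> B}) (h : 'I_n -> B) :
  exists g : {rmorphism {mpoly k[n]} -> B},
    (forall c, g c%:MP = f c) /\ forall i, g 'X_i = h i.
Proof.
exists (GRing.RMorphism.clone _ _ (mmap f h) _); split=> [c|i] /=.
  exact: mmapC.
by rewrite mmapX mmap1U.
Qed.

Lemma mpoly_rmorph_id (k : comNzRingType) n (g : {rmorphism {mpoly k[n]} -> {mpoly k[n]}}) :
  (forall c, g c%:MP = c%:MP) -> (forall i, g 'X_i = 'X_i) -> forall f, g f = f.
Proof.
move=> gC gX f; rewrite {1}(mpolyE f) [RHS]mpolyE rmorph_sum; apply: eq_bigr => m _.
rewrite -mul_mpolyC rmorphM gC; congr (_ * _).
rewrite (mpolyXE_id _ m) rmorph_prod; apply: eq_bigr => i _.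
by rewrite rmorphXn gX.
Qed.

End Lifting.

Lemma rmorph_ideal_pow (S T : comNzRingType) (phi : {rmorphism S -> T})
    (I : set S) (J : set T) m : (forall f, I f -> J (phi f)) ->
  forall f, ideal_pow I m f -> ideal_pow J m (phi f).
Proof.
move=> IJ; apply: (ideal_pow_min (F := fun m => phi @^-1` (ideal_pow J m))) => //.
  by move=> q; apply: preimage_idealP; apply: ideal_powP.
move=> q x y /IJ Jx Jy; rewrite /preimage /= rmorphM; exact: ideal_powS.
Qed.

Lemma rmorph_ideal2 (S T : comNzRingType) (phi : {rmorphism S -> T}) (f g h : S) :
  ideal2 f g h -> ideal2 (phi f) (phi g) (phi h).
Proof.
move=> [_ [_ [[p ->] [q ->] ->]]]; rewrite rmorphD !rmorphM.
by exists (phi p * phi f), (phi q * phi g); split=> //; [exists (phi p)|exists (phi q)].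
Qed.

Lemma idealr_of_ideal (R : comNzRingType) (I : set R) : is_ideal I -> ~ I 1 ->
  exists J : idealr R, [set` J] = I.
Proof.
move=> iI I1; pose P : {pred R} := fun x => `[< I x >].
have cP : idealr_closed P.
  split=> [||a u v]; rewrite !unfold_in.
  - by apply/asboolP; apply: ideal0.
  - by apply/asboolPn.
  - move=> /asboolP Iu /asboolP Iv; apply/asboolP; apply: idealD => //.
    exact: ideal_mull.
pose J : idealr R := HB.pack P (isIdealr.Build R P cP).
by exists J; apply/seteqP; split=> x /asboolP.
Qed.

(** * Coordinates adapted to the two diagonals *)

Section FourVariables.
Variables (k : fieldType) (n : nat) (a b c d : 'I_n).
Local Notation S := {mpoly k[n]}.
Hypothesis us : uniq [:: a; b; c; d].
Hypothesis cov : forall i, i \in [:: a; b; c; d].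

(* [D] stands for the polynomial ring [k[s][t]], with [s = x_a - x_c] and
   [t = x_b - x_d], over which [k[x_a, x_b, x_c, x_d]] is [D[x_a][x_b]]. *)
Let four_variables_over (D : comNzRingType) (kap : {rmorphism k -> D}) (sig tau : D)
    (del : {rmorphism D -> S}) :
  (forall (B : comNzRingType) (f g : {rmorphism D -> B}),
    (forall e, f (kap e) = g (kap e)) -> f sig = g sig -> f tau = g tau ->
    forall h, f h = g h) ->
  (forall e, del (kap e) = e%:MP) ->
  del sig = 'X_a - 'X_c -> del tau = 'X_b - 'X_d ->
  exists (Phi : {rmorphism {poly {poly D}} -> S})
         (Psi : {rmorphism S -> {poly {poly D}}}),
  [/\ forall h, Psi (Phi h) = h, forall f, Phi (Psi f) = f,
      Phi (ci_f sig)%:P = 'X_a * 'X_c &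
      Phi (ci_g tau) = 'X_b * 'X_d].
Proof.
move=> extD delk dels delt.
have [f3 [f3C f3X]] := poly_lift del 'X_a.
have [Phi [PhiC PhiX]] := poly_lift f3 'X_b.
pose C2 : {rmorphism D -> {poly {poly D}}} :=
  GRing.RMorphism.clone _ _ (polyC \o polyC) _.
pose kap' : {rmorphism k -> {poly {poly D}}} := GRing.RMorphism.clone _ _ (C2 \o kap) _.
pose x : {poly {poly D}} := 'X%:P; pose y : {poly {poly D}} := 'X.
have [Psi [PsiC PsiX]] := mpoly_lift kap' (fun i =>
  if i == a then x else if i == c then x - C2 sig
  else if i == b then y else y - C2 tau).
have PC h : Phi (C2 h) = del h by rewrite /= PhiC f3C.
have Px : Phi x = 'X_a by rewrite PhiC f3X.
have [Xa Xc Xb Xd] : [/\ Psi 'X_a = x, Psi 'X_c = x - C2 sig, Psi 'X_b = y &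
    Psi 'X_d = y - C2 tau].
  move: us; rewrite /= !inE !negb_or => /and4P[/and3P[ab ac ad] /andP[bc bd] cd _].
  have [ba ca da dc db] : [/\ b != a, c != a, d != a, d != c & d != b].
    by split; rewrite eq_sym.
  by rewrite !PsiX !eqxx (negPf ba) (negPf ca) (negPf da) (negPf bc) (negPf dc) (negPf db).
(* On [D] the composite is the inclusion, since by [extD] a morphism out of [D] is determined on
   [k], [sig] and [tau]. *)
have Q0 h : Psi (Phi (C2 h)) = C2 h.
  rewrite PC; move: h; apply: (extD _ (GRing.RMorphism.clone _ _ (Psi \o del) _) C2).
  - by move=> e; rewrite /= delk PsiC.
  - by rewrite /= dels rmorphB Xa Xc subKr.
  - by rewrite /= delt rmorphB Xb Xd subKr.
exists Phi, Psi; split.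
- apply: (poly2_rmorph_ext (f := GRing.RMorphism.clone _ _ (Psi \o Phi) _)
    (g := GRing.RMorphism.clone _ _ idfun _)) => [e||] /=.
  + exact: Q0.
  + by rewrite -/x Px Xa.
  + by rewrite PhiX Xb.
- apply: (mpoly_rmorph_id (g := GRing.RMorphism.clone _ _ (Phi \o Psi) _)) => [e|i] /=.
    by rewrite PsiC PC.
  have := cov i; rewrite !inE => /or4P[] /eqP ->.
  + by rewrite Xa Px.
  + by rewrite Xb PhiX.
  + by rewrite Xc rmorphB Px PC dels subKr.
  + by rewrite Xd rmorphB PhiX PC delt subKr.
- by rewrite /ci_f polyCM polyCB rmorphM rmorphB Px [Phi _%:P%:P]PC dels subKr.
- by rewrite /ci_g rmorphM rmorphB PhiX [Phi _%:P%:P]PC delt subKr.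
Qed.

Lemma four_variables_iso :
  exists (Phi : {rmorphism {poly {poly {poly {poly k}}}} -> S})
         (Psi : {rmorphism S -> {poly {poly {poly {poly k}}}}}),
  [/\ forall h, Psi (Phi h) = h, forall f, Phi (Psi f) = f,
      Phi (ci_f 'X%:P)%:P = 'X_a * 'X_c &
      Phi (ci_g 'X) = 'X_b * 'X_d].
Proof.
have [f1 [f1C f1X]] := poly_lift (@mpolyC n k) ('X_a - 'X_c : S).
have [del [delC delX]] := poly_lift f1 ('X_b - 'X_d).
apply: (four_variables_over (kap := GRing.RMorphism.clone _ _ (polyC \o polyC) _) (del := del)).
- by move=> B f g; apply: poly2_rmorph_ext.
- by move=> e; rewrite /= delC f1C.
- by rewrite delC f1X.
- exact: delX.
Qed.

End FourVariables.

Section FourCycle.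
Variables (k : fieldType) (n : nat) (G : simple_graph n).
Local Notation S := {mpoly k[n]}.

Lemma is_cycle4P : is_cycle_of_length G 4 -> exists a b c d,
  [/\ uniq [:: a; b; c; d], forall i, i \in [:: a; b; c; d],
      [/\ edge G a b, edge G b c, edge G c d & edge G d a],
      ~~ edge G a c & ~~ edge G b d].
Proof.
move=> [s [_ ss us eG]].
case: s ss us eG => [|a [|b [|c [|d [|? ?]]]]] // _ us eG.
(* Every vertex has an edge, and the ends of an edge lie on the cycle. *)
have cov i : i \in [:: a; b; c; d].
  by have [j] := edge_no_isolated G i; rewrite eG => /andP[].
have := us; rewrite /= !inE !negb_or.
move=> /and4P[/and3P[ab ac ad] /andP[bc bd] cd _].
have [ba ca da] : [/\ b != a, c != a & d != a] by split; rewrite eq_sym.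
have [cb db dc] : [/\ c != b, d != b & d != c] by split; rewrite eq_sym.
have E := (negPf ab, negPf ac, negPf ad, negPf bc, negPf bd, negPf cd,
  (negPf ba, negPf ca, negPf da, negPf cb, negPf db, negPf dc)).
by exists a, b, c, d; split; rewrite // !eG !cov /= !(eqxx, E).
Qed.

Lemma nonedge_ideal a c : a != c -> ~~ edge G a c -> graph_ideal k G ('X_a * 'X_c).
Proof.
move=> ac nac; rewrite -mpolyXD graph_idealX => i j eij.
have := nonedge_off eij ac nac; have [oa _|_] := boolP (off i j a).
  by exists a => //; rewrite mnmDE mnm1E eqxx.
have [oc _|//] := boolP (off i j c).
by exists c => //; rewrite mnmDE !mnm1E eqxx addn1.
Qed.

(** The support of a monomial of [I] meets the complement of each edge, which is the opposite edge.
    It is thus a vertex cover of the four-cycle and contains one of the diagonal pairs. *)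
Lemma cycle4_graph_ideal a b c d : a != c -> b != d ->
  [/\ edge G a b, edge G b c, edge G c d & edge G d a] ->
  (forall i, i \in [:: a; b; c; d]) ->
  graph_ideal k G `<=` ideal2 ('X_a * 'X_c) ('X_b * 'X_d).
Proof.
move=> nac nbd [eab ebc ecd eda] cov; rewrite graph_idealE.
have pP (z : S) : is_ideal (principal z) := principalP z.
apply: monomial_ideal_min; first exact: ideal_addP.
move=> u hu.
have pair i j : u i != 0%N -> u j != 0%N -> i != j -> principal ('X_i * 'X_j : S) 'X_[u].
  move=> ui uj ij; have uE : (u - (U_(i) + U_(j)) + (U_(i) + U_(j)) = u)%MM.
    apply: submK; apply/mnm_lepP => t; rewrite mnmDE !mnm1E.
    have [<-|_] := eqVneq i t; first by rewrite eq_sym (negPf ij) addn0 lt0n.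
    by have [<-|_] := eqVneq j t; rewrite // add0n lt0n.
  by exists 'X_[u - (U_(i) + U_(j))]; rewrite -!mpolyXD uE.
have sup i j x y : edge G i j -> [:: a; b; c; d] =i [:: i; j; x; y] ->
    (u x != 0%N) || (u y != 0%N).
  move=> eij ms; have [t [ti tj ut]] := graph_monomial_supp hu eij.
  have := cov t; rewrite ms !inE (negPf ti) (negPf tj) /=.
  by case/orP => /eqP <-; rewrite ut ?orbT.
have cd := sup a b c d eab (fun=> erefl).
have ad : (u a != 0%N) || (u d != 0%N).
  by apply: (sup b c) => // z; rewrite !inE; do 4!case: (z == _).
have ab : (u a != 0%N) || (u b != 0%N).
  by apply: (sup c d) => // z; rewrite !inE; do 4!case: (z == _).
have bc : (u b != 0%N) || (u c != 0%N).
  by apply: (sup d a) => // z; rewrite !inE; do 4!case: (z == _).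
case: (boolP ((u a != 0%N) && (u c != 0%N))) => [/andP[ua uc]|uac].
  by apply: ideal_addl => //; apply: pair.
have /andP[ub ud] : (u b != 0%N) && (u d != 0%N).
  by move: cd ad ab bc uac; do 4!case: (u _ != 0%N).
by apply: ideal_addr => //; apply: pair.
Qed.

Theorem cycle_cohen_macaulay_pow m : (0 < m)%N -> is_cycle_of_length G 4 ->
  cohen_macaulay_ideal (ideal_pow (graph_ideal k G) m).
Proof.
move=> m0 /is_cycle4P [a [b [c [d [us cov edges nac nbd]]]]].
have [Phi [Psi [PsiK PhiK Pf Pg]]] := four_variables_iso k us cov.
have [ac bd] : a != c /\ b != d.
  by move: us; rewrite /= !inE !negb_or => /and4P[/and3P[_ -> _] /andP[_ ->] _ _].
have iI := ideal_powP (graph_ideal k G) m.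
(* The power is proper, as it lies in the prime of the edge [a b]. *)
have [|J JI] := idealr_of_ideal iI.
  move/(ideal_powW m0); case: edges => eab _ _ _.
  suff sub : ideal_pow (graph_ideal k G) 1 `<=` var_ideal (off a b).
    by move=> /sub; have [_ + _] := @var_ideal_prime k n (off a b); apply.
  apply: ideal_gen_min; first exact: var_idealP.
  move=> _ [f [g [If _ ->]]]; apply: (ideal_mulr _ (var_idealP _ _)).
  by have := If (a, b) eab; rewrite pair_primeE.
exists J; split => //.
have JE f : f \in J <-> ideal_pow (graph_ideal k G) m f by rewrite -JI.
pose rho : {rmorphism {poly {poly {poly {poly k}}}} -> {ideal_quot J}} :=
  GRing.RMorphism.clone _ _ (\pi_({ideal_quot J})%qT \o Phi) _.
have rho_surj r : exists h, rho h = r.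
  have [f <-] := ideal_quot_surj r; exists (Psi f).
  by rewrite /= PhiK.
(* The isomorphism matches [I] with [(x_a x_c, x_b x_d)], hence their powers; each inclusion is
   transported along one direction. *)
have rho_ker h : rho h = 0 <-> ideal_pow (ci_ideal 'X%:P 'X) m h.
  have -> : rho h = 0 <-> ideal_pow (graph_ideal k G) m (Phi h).
    by rewrite -JE -ideal_quot_eq0; split=> [/= ->|/eqP].
  split=> [/(rmorph_ideal_pow (phi := Psi) (J := ci_ideal 'X%:P 'X)) H|].
    rewrite -[h]PsiK; apply: H => f /(cycle4_graph_ideal ac bd edges cov).
    by move/(rmorph_ideal2 Psi); rewrite -Pf -Pg !PsiK.
  apply: rmorph_ideal_pow => f /(rmorph_ideal2 Phi); rewrite Pf Pg.
  move=> [_ [_ [[p ->] [q ->] ->]]]; have iG := graph_ideal_ideal k G.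
  by apply: (idealD iG); apply: (ideal_mull _ iG); apply: nonedge_ideal.
pose chi : {rmorphism {poly {poly k}} -> {ideal_quot J}} :=
  GRing.RMorphism.clone _ _ (rho \o (polyC \o polyC)) _.
apply: (ci_cohen_macaulay rho_surj rho_ker (chi := chi)) => //.
apply: (noetherian_surj (pi := rho)) => //.
exact/noetherian_poly/noetherian_poly/noetherian_poly/noetherian_poly/noetherian_field.
Qed.

End FourCycle.

Theorem corollary3p5 (k : fieldType) (n : nat) (hn : (4 <= n)%N)
    (G : simple_graph n) (m : nat) (hm : (3 <= m)%N) :
  cohen_macaulay_ideal (ideal_pow (graph_ideal k G) m) <->
  is_cycle_of_length G 4.
Proof.
split; first exact: cohen_macaulay_pow_cycle.
by apply: cycle_cohen_macaulay_pow; apply: leq_trans hm.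
Qed.
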